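(* Let $(G'_t)_{t\ge0}$ be a sequence of matrices in $\mathbb R^{n\times p}$ converging to a matrix $G'$ such that $A-G'C$ is stable, and consider the filter $\hat x'_{t+1}=A\hat x'_t+G'_t(y_t-C\hat x'_t)$. For $c\in(0,\bar c]$ sufficiently small (i.e. there is $c_0\in(0,\bar c]$ such that for all $c\in(0,c_0]$), the prediction error $e'_t=x_t-\hat x'_t$ of this filter under the steady-state least favorable model has zero mean for every $t\geq 0$ and bounded variance, i.e. the covariance matrix of $e'_t$ is bounded uniformly in $t\ge0$.
   Context: Notation. $\sigma(M)$ is the spectral radius of a square matrix $M$ (with $\sigma(M)^{-1}=+\infty$ if $\sigma(M)=0$); $M$ is stable if $\sigma(M)<1$. Inequalities between symmetric matrices are in the positive semidefinite (Loewner) order; $X>0$ means positive definite. Robust filter. $A\in\mathbb R^{n\times n}$, $B\in\mathbb R^{n\times m}$, $C\in\mathbb R^{p\times n}$, $D\in\mathbb R^{p\times m}$, with $(A,B)$ reachable, $(A,C)$ observable, $BD^T=0$, $m=n+p$, and the stacked matrix $[B^T\ D^T]^T$ square and invertible. For a tolerance $c>0$ and $P_0>0$, put $V_0=P_0$, $\hat x_0=0$, and for $t\ge0$ $$G_t=AV_tC^T(CV_tC^T+DD^T)^{-1},\quad \hat x_{t+1}=A\hat x_t+G_t(y_t-C\hat x_t),$$ $$P_{t+1}=A(V_t^{-1}+C^T(DD^T)^{-1}C)^{-1}A^T+BB^T,\quad V_{t+1}=(P_{t+1}^{-1}-\theta_tI)^{-1},$$ where $\theta_t\in(0,\sigma(P_{t+1})^{-1})$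 is the unique solution of $c=\gamma(P_{t+1},\theta_t)$, with $\gamma(P,\theta)=\frac12\left[\log\det(I-\theta P)+\mathrm{tr}[(I-\theta P)^{-1}]-n\right]$. Known fact: there is $c_{MAX}>0$ such that for $c\in(0,c_{MAX}]$ and any $P_0>0$: $P_t\to P>0$, $\theta_t\to\theta>0$, $V_t\to V>0$, $G_t\to G$ with $A-GC$ stable, and $P$ is the unique solution of $P=A(P^{-1}-\theta I+C^T(DD^T)^{-1}C)^{-1}A^T+BB^T$. Fix such a $c_{MAX}$. For $c\in(0,c_{MAX}]$ the symbols $\theta,P,V,G$ denote these limits (depending on $c$), and $\bar A:=A-GC$ (stable), $\bar B:=B-GD$; $\bar B\bar B^T$ is invertible. $\bar A,\bar B$ depend on $c$ through $\theta$; for $\theta=0$ they are given by the same formulas with $P$ the solution of the Riccati equation above for $\theta=0$ (standard Kalman filter, $V=P$). Standing assumption (Assumption 1): for $\check\theta>0$ sufficiently small, the map $\theta\mapsto(\bar A,\bar B)$ is continuous on $[0,\check\theta]$. The constant $\bar c$. For $\rho\in(1,\sigma(\bar A)^{-1})$, $\Sigma_\rho$ is the unique solution of $\Sigma_\rho=\rho^2\bar A^T\Sigma_\rho\bar A+\theta I$. $\bar c\in(0,c_{MAX}]$ is fixed such that there is a $\rho>1$ for which, for every $c\in(0,\bar c]$ (with the corresponding $\theta,\bar A,\bar B$), one has $\rho\in(1,\sigma(\bar A)^{-1})$ and $(1-\rho^{-2})\Sigma_\rho^{-1}-\bar B\bar B^T\ge0$. Steady-state least favorable model. For $c\in(0,\bar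 c]$, the backward recursion $X_t=\bar A^T(X_{t+1}^{-1}-\bar B\bar B^T)^{-1}\bar A+\theta I$, $X_T=\theta I$, converges as $t\to-\infty$ to a matrix $X$ with $\theta I\le X\le\Sigma_\rho<(\bar B\bar B^T)^{-1}$. Put $$\tilde K=(I-\bar B^TX\bar B)^{-1}=LL^T,\quad H=\tilde K\bar B^TX\bar A,$$ $$\tilde A=\begin{bmatrix}A&BH\\0&\bar A+\bar BH\end{bmatrix},\quad \tilde B=\begin{bmatrix}B\\ \bar B\end{bmatrix}L,\quad \tilde C=\begin{bmatrix}C&DH\end{bmatrix},\quad \tilde D=DL .$$ The steady-state least favorable model is $\xi_{t+1}=\tilde A\xi_t+\tilde B\varepsilon_t$, $y_t=\tilde C\xi_t+\tilde D\varepsilon_t$, with $\varepsilon_t$ white Gaussian noise of unit variance. Under it (known fact, used as the definition of the error process), with $e_t=x_t-\hat x_t$ the error of the robust filter, the joint error $\mathbf e_t=[e_t'^{\,T}\ e_t^T]^T$ satisfies $$\mathbf e_{t+1}=F_t\mathbf e_t+M_t\varepsilon_t,\quad F_t=\tilde A-\begin{bmatrix}G'_t\\0\end{bmatrix}\tilde C,\quad M_t=\tilde B-\begin{bmatrix}G'_t\\0\end{bmatrix}\tilde D,$$ with $\mathbf e_0$ of zero mean and covariance $\Pi_0=I_2\otimes V_0$, independent of $(\varepsilon_t)_{t\ge0}$. *)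

(* Defs.v *)
From HB Require Import structures.
From mathcomp Require Import all_boot all_order all_algebra.
From mathcomp Require Import all_classical all_reals all_analysis.
From mathcomp Require Import complex.
Set Implicit Arguments.
Unset Strict Implicit.
Unset Printing Implicit Defensive.
Import Order.TTheory GRing.Theory Num.Theory numFieldNormedType.Exports.
Local Open Scope classical_set_scope.
Local Open Scope ring_scope.

Section LinearAlgebra.
Context {R : realType}.

(* Largest modulus of a complex eigenvalue. *)
Definition spectral_radius n (M : 'M[R]_n) : R :=
  sup [set complex.Re `|l| | l in
        [set l : R[i] | eigenvalue (map_mx (real_complex R) M) l]].

(* In \bar R, 0^-1 = +oo. *)
Definition inv_spectral_radius n (M : 'M[R]_n) : \bar R :=
  ((spectral_radius M)%:E^-1)%E.

Definition stable n (M : 'M[R]_n) : Prop := spectral_radius M < 1.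

Definition psdmx n (M : 'M[R]_n) : Prop :=
  M^T = M /\ forall x : 'cV[R]_n, 0 <= (x^T *m M *m x) 0 0.

Definition pdmx n (M : 'M[R]_n) : Prop :=
  M^T = M /\ forall x : 'cV[R]_n, x != 0 -> 0 < (x^T *m M *m x) 0 0.

Definition loewner_le n (M N : 'M[R]_n) : Prop := psdmx (N - M).
Definition loewner_lt n (M N : 'M[R]_n) : Prop := pdmx (N - M).

Definition reachable n m (A : 'M[R]_n) (B : 'M[R]_(n, m)) : Prop :=
  \rank (\mxrow_(i < n) (A ^+ i *m B)) = n.

Definition observable n p (A : 'M[R]_n) (C : 'M[R]_(p, n)) : Prop :=
  \rank (\mxcol_(i < n) (C *m A ^+ i)) = n.

End LinearAlgebra.

Section RobustFilter.
Context {R : realType} {n m p : nat}.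
Implicit Types (A P V : 'M[R]_n) (B : 'M[R]_(n, m)) (C : 'M[R]_(p, n))
  (D : 'M[R]_(p, m)) (G : 'M[R]_(n, p)) (c th : R).

Definition gamma P th : R :=
  2^-1 * (ln (\det (1%:M - th *: P)) + \tr (invmx (1%:M - th *: P)) - n%:R).

Definition gain A C D V : 'M[R]_(n, p) :=
  A *m V *m C^T *m invmx (C *m V *m C^T + D *m D^T).

(* Riccati update as a function of the information matrix V^-1. *)
Definition riccati A B C D (Vinv : 'M[R]_n) : 'M[R]_n :=
  A *m invmx (Vinv + C^T *m invmx (D *m D^T) *m C) *m A^T + B *m B^T.

Definition risk_var th P : 'M[R]_n := invmx (invmx P - th%:M).

Definition is_risk c P th : Prop :=
  [/\ 0 < th, (th%:E < inv_spectral_radius P)%E & c = gamma P th].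

Definition robust_filter A B C D c (P0 : 'M[R]_n)
    (P V : nat -> 'M[R]_n) (G : nat -> 'M[R]_(n, p)) (th : nat -> R) : Prop :=
  [/\ P 0%N = P0 /\ V 0%N = P0,
      forall t, G t = gain A C D (V t),
      forall t, P t.+1 = riccati A B C D (invmx (V t)),
      forall t, unique (is_risk c (P t.+1)) (th t) &
      forall t, V t.+1 = risk_var (th t) (P t.+1)].

(* The solutions considered are those for which V = (P^-1 - th I)^-1 makes
   sense as a covariance matrix; without the two positivity requirements
   the Riccati equation has further solutions. *)
Definition riccati_solution A B C D th P : Prop :=
  [/\ pdmx P, pdmx (invmx P - th%:M) & P = riccati A B C D (invmx P - th%:M)].

(* th, P, V, G are the limits of the robust filter with tolerance c; they do
   not depend on the initial condition P0. *)
Definition steady_state A B C D c th P V G : Prop :=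
  [/\ forall P0, pdmx P0 -> exists Pt Vt Gt tht,
        [/\ robust_filter A B C D c P0 Pt Vt Gt tht,
            tht @ \oo --> th, Pt @ \oo --> P,
            Vt @ \oo --> V & Gt @ \oo --> G],
      [/\ 0 < th, pdmx P & pdmx V],
      stable (A - G *m C) &
      unique (riccati_solution A B C D th) P].

Definition Abar A C G : 'M[R]_n := A - G *m C.
Definition Bbar B D G : 'M[R]_(n, m) := B - G *m D.

(* The map th |-> (Abar, Bbar) is obtained from the solution P of the Riccati
   equation with parameter th; for th = 0 one has risk_var 0 P = P, i.e. the
   standard Kalman filter. *)
Definition continuous_steady_state A B C D : Prop :=
  \forall thc \near 0^'+, exists P : R -> 'M[R]_n,
    (forall th, 0 <= th <= thc ->
       unique (riccati_solution A B C D th) (P th)) /\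
    {within `[0, thc], continuous (fun th =>
       let G := gain A C D (risk_var th (P th)) in
       (Abar A C G, Bbar B D G))}.

Definition Sigma_equation (rho th : R) (Ab S : 'M[R]_n) : Prop :=
  S = rho ^+ 2 *: (Ab^T *m S *m Ab) + th%:M.

Definition cbar_condition A B C D (cbar rho : R) : Prop :=
  forall c, 0 < c <= cbar ->
  forall th P V G, steady_state A B C D c th P V G ->
  (rho%:E < inv_spectral_radius (Abar A C G))%E /\
  exists2 S, unique (Sigma_equation rho th (Abar A C G)) S &
    psdmx ((1 - rho ^- 2) *: invmx S - Bbar B D G *m (Bbar B D G)^T).

(* X_seq k is the iterate X_(T - k) of the backward recursion. *)
Fixpoint X_seq th (Ab : 'M[R]_n) (Bb : 'M[R]_(n, m)) (k : nat) : 'M[R]_n :=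
  if k is k'.+1 then
    Ab^T *m invmx (invmx (X_seq th Ab Bb k') - Bb *m Bb^T) *m Ab + th%:M
  else th%:M.

Definition backward_limit (rho th : R) (Ab : 'M[R]_n) (Bb : 'M[R]_(n, m))
    (X : 'M[R]_n) : Prop :=
  X_seq th Ab Bb @ \oo --> X /\
  exists S, [/\ unique (Sigma_equation rho th Ab) S,
    loewner_le th%:M X, loewner_le X S & loewner_lt S (invmx (Bb *m Bb^T))].

Definition Ktilde (Bb : 'M[R]_(n, m)) (X : 'M[R]_n) : 'M[R]_m :=
  invmx (1%:M - Bb^T *m X *m Bb).

Definition Hmx (Ab : 'M[R]_n) (Bb : 'M[R]_(n, m)) (X : 'M[R]_n) :
    'M[R]_(m, n) :=
  Ktilde Bb X *m Bb^T *m X *m Ab.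

Definition Atilde A B (Ab : 'M[R]_n) (Bb : 'M[R]_(n, m)) (H : 'M[R]_(m, n)) :
    'M[R]_(n + n) :=
  block_mx A (B *m H) 0 (Ab + Bb *m H).
Definition Btilde B (Bb : 'M[R]_(n, m)) (L : 'M[R]_m) : 'M[R]_(n + n, m) :=
  col_mx B Bb *m L.
Definition Ctilde C D (H : 'M[R]_(m, n)) : 'M[R]_(p, n + n) :=
  row_mx C (D *m H).
Definition Dtilde D (L : 'M[R]_m) : 'M[R]_(p, m) := D *m L.

(* F_t and M_t for a filter with gain Gp under the model built from the robust
   gain G, the matrix X and the factor L. *)
Definition Fmx A B C D G (X : 'M[R]_n) (Gp : 'M[R]_(n, p)) : 'M[R]_(n + n) :=
  let H := Hmx (Abar A C G) (Bbar B D G) X in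
  Atilde A B (Abar A C G) (Bbar B D G) H - col_mx Gp 0 *m Ctilde C D H.
Definition Mmx B D G (L : 'M[R]_m) (Gp : 'M[R]_(n, p)) : 'M[R]_(n + n, m) :=
  Btilde B (Bbar B D G) L - col_mx Gp 0 *m Dtilde D L.

End RobustFilter.

Section Probability.
Context {R : realType} {d : measure_display} {T : measurableType d}.
Variable Pr : probability T R.

Definition mutually_independent (I : eqType) (X : I -> {RV Pr >-> R}) : Prop :=
  forall (s : seq I) (B : I -> set R), uniq s -> (forall i, measurable (B i)) ->
  Pr (\big[setI/setT]_(i <- s) (X i @^-1` B i)) =
  (\prod_(i <- s) Pr (X i @^-1` B i))%E.

Definition sigma_generated (I : Type) (X : I -> {RV Pr >-> R}) : set (set T) :=
  <<s \bigcup_i preimage_set_system setT (X i) measurable >>.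

Definition independent_families (I J : Type) (X : I -> {RV Pr >-> R})
    (Y : J -> {RV Pr >-> R}) : Prop :=
  forall E F, sigma_generated X E -> sigma_generated Y F ->
  Pr (E `&` F) = (Pr E * Pr F)%E.

(* Gaussian with covariance E[eps_t eps_s^T] = delta_ts I, i.e. all scalar
   components at all times are independent and N(0, 1). *)
Definition white_gaussian k (eps : nat -> 'I_k -> {RV Pr >-> R}) : Prop :=
  (forall t i, distribution Pr (eps t i) = normal_prob 0 1 :> (set _ -> \bar R)) /\
  mutually_independent (fun ti : nat * 'I_k => eps ti.1 ti.2).

Definition sample k (X : 'I_k -> {RV Pr >-> R}) (w : T) : 'cV[R]_k :=
  \col_i X i w.

Definition square_integrable k (X : 'I_k -> {RV Pr >-> R}) : Prop :=
  forall i, (X i : T -> R) \in Lfun Pr 2%:E.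

Definition zero_mean k (X : 'I_k -> {RV Pr >-> R}) : Prop :=
  forall i, ('E_Pr[X i] = 0)%E.

(* Meaningful for square integrable X, for which all entries are finite. *)
Definition covmx k (X : 'I_k -> {RV Pr >-> R}) : 'M[R]_k :=
  \matrix_(i, j) fine (covariance Pr (X i) (X j)).

Definition joint_error n k (F : nat -> 'M[R]_(n + n)) (M : nat -> 'M[R]_(n + n, k))
    (V0 : 'M[R]_n) (eps : nat -> 'I_k -> {RV Pr >-> R})
    (e : nat -> 'I_(n + n) -> {RV Pr >-> R}) : Prop :=
  [/\ white_gaussian eps,
      [/\ square_integrable (e 0%N), zero_mean (e 0%N) &
          covmx (e 0%N) = block_mx V0 0 0 V0],
      independent_families (e 0%N) (fun ti : nat * 'I_k => eps ti.1 ti.2) &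
      forall t w,
        sample (e t.+1) w = F t *m sample (e t) w + M t *m sample (eps t) w].

(* The first n components e'_t of [e'_t; e_t]. *)
Definition prediction_error n (e : nat -> 'I_(n + n) -> {RV Pr >-> R}) :
    nat -> 'I_n -> {RV Pr >-> R} :=
  fun t i => e t (lshift n i).

End Probability.

(* Main.v *)
(* The joint error is driven by a block triangular matrix with diagonal limit
   blocks A - G'C, which is stable by assumption, and
   Abar + Bbar H = (1 - Bbar Bbar^T X)^-1 Abar.  As c -> 0 the risk parameter
   th(c) tends to 0: Hadamard's inequality applied to N = (1 - th P)^-1 gives
   2c >= u - ln (1 + u) with u = th P_ii, and P >= B B^T keeps P_ii away from 0.
   By uniqueness of the Riccati solution, (Abar, Bbar) then tends to its value
   for the Kalman filter (th = 0), whose error covariance Z satisfies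
   Z - Abar Z Abar^T = Bbar Bbar^T > 0.  A comparison argument bounds the
   iterates X_k by O(th) Z^-1, so X tends to 0 and Z is still a Lyapunov matrix
   for Abar + Bbar H when c is small.  Hence the limit of F_t has a Lyapunov
   matrix, and Pi_(t+1) = F_t Pi_t F_t^T + M_t M_t^T stays bounded. *)
Require Import Defs.
From mathcomp Require Import all_boot all_order all_algebra.
From mathcomp Require Import all_classical all_reals all_analysis.
From mathcomp Require Import measurable_realfun complex ring lra.
Set Implicit Arguments.
Unset Strict Implicit.
Unset Printing Implicit Defensive.
Import Order.TTheory GRing.Theory Num.Theory numFieldNormedType.Exports.
Local Open Scope classical_set_scope.
Local Open Scope ring_scope.

(** * Positive definite matrices *)

Section Loewner.
Context {R : realType}.

(** Stability is handled as a Lyapunov inequality [Z - F Z F^T > 0] because this is an open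
    condition on [F]: one [Z] then serves every small tolerance and also survives the passage from a
    limit matrix to the time-varying [F_t], whereas spectral radii of factors do not control those
    of products. Eigenvalues are used only to turn [stable] into such a [Z] for [A - G'C]. The
    backward recursion acts with [Abar^T] on the left, so it is compared with [Z^-1], which
    satisfies the transposed inequality by Schur complement duality. A second difficulty is that the
    steady state is known only as a limit: its algebraic relations are carried over from the
    trajectory after being rewritten without inverses. The tolerance equation is not passed to the
    limit; it yields a bound on [th_t] for large [t], and bounds survive limits. *)

Definition qform n (M : 'M[R]_n) (x : 'cV[R]_n) : R := (x^T *m M *m x) 0 0.

Lemma qformD n (M N : 'M[R]_n) x : qform (M + N) x = qform M x + qform N x.
Proof. by rewrite /qform mulmxDr mulmxDl mxE. Qed.

Lemma qformN n (M : 'M[R]_n) x : qform (- M) x = - qform M x.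
Proof. by rewrite /qform mulmxN mulNmx mxE. Qed.

Lemma qformB n (M N : 'M[R]_n) x : qform (M - N) x = qform M x - qform N x.
Proof. by rewrite qformD qformN. Qed.

Lemma qformZ n a (M : 'M[R]_n) x : qform (a *: M) x = a * qform M x.
Proof. by rewrite /qform -scalemxAr -scalemxAl mxE. Qed.

Lemma qform_congr n k (K : 'M[R]_(n, k)) M x :
  qform (K *m M *m K^T) x = qform M (K^T *m x).
Proof. by rewrite /qform trmx_mul trmxK !mulmxA. Qed.

Lemma qform1 n (x : 'cV[R]_n) : qform 1%:M x = \sum_i x i 0 ^+ 2.
Proof.
by rewrite /qform mulmx1 mxE; apply: eq_bigr => i _; rewrite mxE expr2.
Qed.

Lemma qform_scalar n a (x : 'cV[R]_n) : qform a%:M x = a * qform 1%:M x.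
Proof. by rewrite -[a%:M]scalemx1 qformZ. Qed.

Lemma qform1_ge0 n (x : 'cV[R]_n) : 0 <= qform 1%:M x.
Proof. by rewrite qform1 sumr_ge0// => i _; exact: sqr_ge0. Qed.

Lemma qform1_gt0 n (x : 'cV[R]_n) : x != 0 -> 0 < qform 1%:M x.
Proof.
move=> x0; rewrite lt_def qform1_ge0 andbT; apply: contra x0.
rewrite qform1 psumr_eq0 => [/allP h|i _]; last exact: sqr_ge0.
apply/eqP/matrixP => i j; rewrite ord1 mxE; apply/eqP.
by rewrite -sqrf_eq0; apply: h; rewrite mem_index_enum.
Qed.

Lemma qform_delta n (M : 'M[R]_n) i : qform M (delta_mx i 0) = M i i.
Proof.
by rewrite /qform trmx_delta -rowE -colE !mxE.
Qed.

Lemma pdmx_psd n (M : 'M[R]_n) : pdmx M -> psdmx M.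
Proof.
case=> sM pM; split=> // x; have [->|/pM/ltW//] := eqVneq x 0.
by rewrite mulmx0 mxE.
Qed.

Lemma psdmx0 n : psdmx (0 : 'M[R]_n).
Proof. by split=> [|x]; rewrite ?trmx0// mulmx0 mul0mx mxE. Qed.

Lemma psdmxD n (M N : 'M[R]_n) : psdmx M -> psdmx N -> psdmx (M + N).
Proof.
move=> [sM pM] [sN pN]; split; first by rewrite linearD/= sM sN.
by move=> x; rewrite -/(qform _ _) qformD addr_ge0// ?pM ?pN.
Qed.

Lemma pdmxD n (M N : 'M[R]_n) : pdmx M -> psdmx N -> pdmx (M + N).
Proof.
move=> [sM pM] [sN pN]; split; first by rewrite linearD/= sM sN.
by move=> x x0; rewrite -/(qform _ _) qformD ltr_wpDr// ?pM ?pN.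
Qed.

Lemma psdmxZ n a (M : 'M[R]_n) : 0 <= a -> psdmx M -> psdmx (a *: M).
Proof.
move=> a0 [sM pM]; split; first by rewrite linearZ/= sM.
by move=> x; rewrite -/(qform _ _) qformZ mulr_ge0// pM.
Qed.

Lemma pdmxZ n a (M : 'M[R]_n) : 0 < a -> pdmx M -> pdmx (a *: M).
Proof.
move=> a0 [sM pM]; split; first by rewrite linearZ/= sM.
by move=> x x0; rewrite -/(qform _ _) qformZ mulr_gt0// pM.
Qed.

Lemma pdmx1 n : pdmx (1%:M : 'M[R]_n).
Proof. by split=> [|x /qform1_gt0]; rewrite ?trmx1. Qed.

Lemma pdmx_scalar n (a : R) : 0 < a -> pdmx (a%:M : 'M[R]_n).
Proof. by move=> a0; rewrite -scalemx1; apply: pdmxZ => //; exact: pdmx1. Qed.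

Lemma psdmx_scalar n (a : R) : 0 <= a -> psdmx (a%:M : 'M[R]_n).
Proof.
move=> a0; rewrite -scalemx1; apply: psdmxZ => //.
exact/pdmx_psd/pdmx1.
Qed.

Lemma psdmx_congr n k (K : 'M[R]_(n, k)) M :
  psdmx M -> psdmx (K *m M *m K^T).
Proof.
move=> [sM pM]; split; first by rewrite !trmx_mul trmxK sM mulmxA.
by move=> x; rewrite -/(qform _ _) qform_congr; exact: pM.
Qed.

Lemma pdmx_congr n (K M : 'M[R]_n) :
  K \in unitmx -> pdmx M -> pdmx (K *m M *m K^T).
Proof.
move=> uK [sM pM]; split; first by rewrite !trmx_mul trmxK sM mulmxA.
move=> x x0; rewrite -/(qform _ _) qform_congr; apply: pM.
apply: contra x0 => /eqP h; rewrite -(mulKmx (_ : K^T \in unitmx) x) ?h ?mulmx0//.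
by rewrite unitmx_tr.
Qed.

Lemma psdmx_gram n k (K : 'M[R]_(n, k)) : psdmx (K *m K^T).
Proof.
by rewrite -[X in X *m _]mulmx1; apply: psdmx_congr; apply/pdmx_psd/pdmx1.
Qed.

Lemma unitmx_col0 n (M : 'M[R]_n) :
  (forall x : 'cV[R]_n, M *m x = 0 -> x = 0) -> M \in unitmx.
Proof.
move=> h; rewrite -unitmx_tr -row_free_unit -kermx_eq0; apply/eqP/row_matrixP.
move=> i; rewrite row0; apply: trmx_inj; rewrite trmx0; apply: h.
by apply: trmx_inj; rewrite trmx_mul trmxK trmx0 -row_mul mulmx_ker row0.
Qed.

Lemma pdmx_unit n (M : 'M[R]_n) : pdmx M -> M \in unitmx.
Proof.
case=> sM pM; apply: unitmx_col0 => x Mx0; apply/eqP/negP => /negP /pM.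
by rewrite -mulmxA Mx0 mulmx0 mxE ltxx.
Qed.

Lemma pdmx_inv n (M : 'M[R]_n) : pdmx M -> pdmx (invmx M).
Proof.
move=> pM; have uM := pdmx_unit pM.
have -> : invmx M = invmx M *m M *m (invmx M)^T.
  by rewrite mulVmx// mul1mx trmx_inv (proj1 pM).
by apply: pdmx_congr => //; rewrite unitmx_inv.
Qed.

Lemma pdmx_gram_unit n k (K : 'M[R]_(n, k)) :
  (forall x : 'cV[R]_n, K^T *m x = 0 -> x = 0) -> pdmx (K *m K^T).
Proof.
move=> h; split; first by rewrite trmx_mul trmxK.
move=> x x0; rewrite -[K]mulmx1 -/(qform _ _) trmx_mul trmx1 mul1mx.
rewrite qform_congr qform1_gt0//; apply: contra x0 => /eqP/h ->//.
Qed.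

(* Completing the square: [S^-1 x - M y] has nonnegative [S]-norm for
   [y = T^-1 M^T x]. *)
Lemma qform_dual n k (S : 'M[R]_n) (T : 'M[R]_k) (M : 'M[R]_(n, k)) x y :
  pdmx S -> pdmx T -> y = invmx T *m M^T *m x ->
  qform (T - M^T *m S *m M) y <= qform (invmx S - M *m invmx T *m M^T) x.
Proof.
move=> pS pT yE.
have uS := pdmx_unit pS; have uT := pdmx_unit pT.
have sT : (invmx T)^T = invmx T by rewrite trmx_inv (proj1 pT).
have sS : (invmx S)^T = invmx S by rewrite trmx_inv (proj1 pS).
have /(_ (invmx S *m x - M *m y)) := proj2 (pdmx_psd pS).
rewrite !qformB; set q := (X in 0 <= X -> _).
have yT : y^T = x^T *m M *m invmx T by rewrite yE !trmx_mul sT trmxK mulmxA.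
have e1 : qform T y = (x^T *m M *m y) 0 0.
  by rewrite /qform yT mulmxKV.
have e2 : qform (M *m invmx T *m M^T) x = (x^T *m M *m y) 0 0.
  by rewrite /qform yE !mulmxA.
have e3 : (x^T *m M *m y) 0 0 = (y^T *m M^T *m x) 0 0.
  by rewrite yT yE !mulmxA.
suff -> : q = qform (invmx S) x - (x^T *m M *m y) 0 0 - (y^T *m M^T *m x) 0 0 +
    qform (M^T *m S *m M) y.
  by rewrite e1 e2 -e3; move: (qform _ _) (qform _ _) (_ 0 0) => a b c; lra.
rewrite /q /qform [(_ - _)^T]linearB/= !trmx_mul sS !(mulmxBl, mulmxBr) !mulmxA.
rewrite !(mulmxK uS, mulmxKV uS) !mxE.
set a := \sum_j _; set b := \sum_j _; set c := \sum_j _; set d := \sum_j _; lra.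
Qed.

(** Both matrices are Schur complements of one block matrix with diagonal blocks [S^-1], [T] and
    corner [M]. In this lemma and its strict version, [M = 1] compares inverses, and [S = T] turns a
    Lyapunov inequality into the one for the transpose and the inverse. *)
Lemma psdmx_dual n k (S : 'M[R]_n) (T : 'M[R]_k) (M : 'M[R]_(n, k)) :
  pdmx S -> pdmx T -> psdmx (T - M^T *m S *m M) ->
  psdmx (invmx S - M *m invmx T *m M^T).
Proof.
move=> pS pT [_ h]; split.
  rewrite linearB/= !trmx_mul trmxK !trmx_inv (proj1 pS) (proj1 pT) mulmxA//.
by move=> x; apply: le_trans _ (qform_dual pS pT erefl); exact: h.
Qed.

Lemma pdmx_dual n k (S : 'M[R]_n) (T : 'M[R]_k) (M : 'M[R]_(n, k)) :
  pdmx S -> pdmx T -> pdmx (T - M^T *m S *m M) ->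
  pdmx (invmx S - M *m invmx T *m M^T).
Proof.
move=> pS pT pd; split.
  exact: (proj1 (psdmx_dual pS pT (pdmx_psd pd))).
(* When [y] vanishes, strictness cannot come from [T - M^T S M]; but then [M T^-1 M^T x = 0] and
   [S^-1] is positive at [x]. *)
move=> x x0; have [y0|yn0] := eqVneq (invmx T *m M^T *m x) 0.
  rewrite -/(qform _ _) qformB {2}/qform -mulmxA -(mulmxA M) -(mulmxA M).
  rewrite y0 !mulmx0 mxE subr0.
  exact: (proj2 (pdmx_inv pS)).
by apply: lt_le_trans _ (qform_dual pS pT erefl); exact: (proj2 pd).
Qed.

Lemma psdmx_invB n (S T : 'M[R]_n) : pdmx S -> pdmx T -> psdmx (T - S) ->
  psdmx (invmx S - invmx T).
Proof.
move=> pS pT h; have := @psdmx_dual _ _ S T 1%:M pS pT.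
by rewrite trmx1 !(mulmx1, mul1mx); apply.
Qed.

Lemma mx_norm_entry m n (M : 'M[R]_(m, n)) i j : `|M i j| <= `|M|.
Proof.
have /(_ (i, j)) := @le_bigmax _ _ _ 0 (fun k : 'I_m * 'I_n => `|M k.1 k.2|).
by rewrite [`|M|]mx_normrE.
Qed.

Lemma mx_norm_le m n (M : 'M[R]_(m, n)) (b : R) : 0 <= b ->
  (forall i j, `|M i j| <= b) -> `|M| <= b.
Proof.
move=> b0 h; rewrite [`|M|]mx_normrE; exact/bigmax_leP.
Qed.

(** Each product [x_i M_ij x_j] is at most [|M| (x_i^2 + x_j^2) / 2]; the norm is the largest entry,
    whence the factor [n]. *)
Lemma psdmx_scalarB n (M : 'M[R]_n) (b : R) : M^T = M -> `|M| *+ n <= b ->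
  psdmx (b%:M - M).
Proof.
move=> sM hb; split; first by rewrite linearB/= tr_scalar_mx sM.
move=> x; rewrite -/(qform _ _) qformB qform_scalar subr_ge0.
apply: (@le_trans _ _ ((`|M| *+ n) * qform 1%:M x)); last first.
  by rewrite ler_wpM2r// qform1_ge0.
rewrite /qform -mulmxA mxE.
apply: (@le_trans _ _ (\sum_i \sum_j `|M| * ((x i 0 ^+ 2 + x j 0 ^+ 2) / 2))).
  apply: ler_sum => i _; rewrite !mxE mulr_sumr; apply: ler_sum => j _.
  apply: (le_trans (ler_norm _)); rewrite !normrM mulrCA ler_pM ?mulr_ge0//.
    exact: mx_norm_entry.
  rewrite -[x i 0 ^+ 2]real_normK ?num_real// -[x j 0 ^+ 2]real_normK ?num_real//.
  move: `|x i 0| `|x j 0| => u v; have := sqr_ge0 (u - v); lra.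
rewrite -/(qform 1%:M x) qform1 -[_ *+ n]mulr_natr -mulrA mulr_sumr.
under eq_bigr => i _ do rewrite -mulr_sumr -mulr_suml big_split/=.
rewrite -[leLHS]mulr_sumr -mulr_suml big_split/= ler_wpM2l//.
rewrite (eq_bigr (fun i => n%:R * x i 0 ^+ 2)) => [|i _]; last first.
  by rewrite sumr_const card_ord mulr_natl.
by rewrite sumr_const card_ord -mulr_natl -mulr_sumr; lra.
Qed.

(** A scalar upper bound on [M^-1] is inverted. The [+ 1] keeps that bound positive even in
    dimension 0. *)
Lemma pdmx_ge_scalar n (M : 'M[R]_n) : pdmx M ->
  exists2 a : R, 0 < a & psdmx (M - a%:M).
Proof.
move=> pM; have pV := pdmx_inv pM; have uM := pdmx_unit pM.
have b0 : 0 < `|invmx M| *+ n + 1 by rewrite ltr_wpDl// mulrn_wge0.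
exists (`|invmx M| *+ n + 1)^-1; first by rewrite invr_gt0.
rewrite -invmx_scalar -{1}[M]invmxK; apply: psdmx_invB => //.
  exact: pdmx_scalar.
by apply: psdmx_scalarB; [exact: (proj1 pV) | rewrite lerDl].
Qed.

Lemma psdmx_le_scale n (M N : 'M[R]_n) : pdmx M -> N^T = N ->
  exists2 a : R, 0 < a & psdmx (a *: M - N).
Proof.
move=> /pdmx_ge_scalar[d d0 hd] sN.
have b0 : 0 < `|N| *+ n + 1 by rewrite ltr_wpDl// mulrn_wge0.
exists ((`|N| *+ n + 1) / d); first by rewrite divr_gt0.
have -> : ((`|N| *+ n + 1) / d) *: M - N =
    ((`|N| *+ n + 1) / d) *: (M - d%:M) + ((`|N| *+ n + 1)%:M - N).
  rewrite scalerBr scale_scalar_mx divfK ?gt_eqF//.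
  by rewrite addrA addrNK.
apply: psdmxD; first by apply: psdmxZ => //; rewrite divr_ge0 ?ltW.
by apply: psdmx_scalarB => //; rewrite lerDl.
Qed.

(** Symmetry is a separate premise because neighbourhoods of [M] also contain nonsymmetric
    matrices. *)
Lemma pdmx_near n (M : 'M[R]_n) : pdmx M ->
  \forall N \near M, N^T = N -> pdmx N.
Proof.
move=> pM; have [d d0 hd] := pdmx_ge_scalar pM.
have e0 : 0 < d / 2 / n.+1%:R by rewrite !divr_gt0.
near=> N => sN.
have -> : N = (d / 2)%:M + (M - d%:M) + ((d / 2)%:M - (M - N)).
  rewrite opprB !addrA; apply/matrixP => i j; rewrite !mxE; lra.
apply: pdmxD.
  by apply: pdmxD => //; apply: pdmx_scalar; rewrite divr_gt0.
apply: psdmx_scalarB; first by rewrite linearB/= sN (proj1 pM).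
have : `|M - N| <= d / 2 / n.+1%:R.
  near: N; apply/nbhs_ballP; exists (d / 2 / n.+1%:R) => //= N.
  by rewrite -ball_normE => /ltW.
rewrite ler_pdivlMr// => h; rewrite -[_ *+ n]mulr_natr; apply: le_trans _ h.
by rewrite ler_wpM2l// ler_nat.
Unshelve. all: by end_near. Qed.

(** The diagonal lies in [[0, a]], and evaluating the form at [e_i + e_j] and [e_i - e_j] bounds
    [2 |M_ij|] by [M_ii + M_jj]. *)
Lemma psdmx_entry_le n (M : 'M[R]_n) (a : R) i j : psdmx M -> psdmx (a%:M - M) ->
  `|M i j| <= a.
Proof.
move=> [sM pM] [_ h].
have diag k : 0 <= M k k <= a.
  have := pM (delta_mx k 0); have := h (delta_mx k 0).
  by rewrite -!/(qform _ _) !qform_delta !mxE eqxx subr_ge0 => -> ->.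
have sij : M j i = M i j by rewrite -[in LHS]sM mxE.
have e (s : R) : qform M (delta_mx i 0 + s *: delta_mx j 0 : 'cV_n) =
    M i i + s * M i j *+ 2 + s ^+ 2 * M j j.
  rewrite /qform.
  have -> : (delta_mx i 0 + s *: delta_mx j 0 : 'cV_n)^T =
      delta_mx 0 i + s *: delta_mx 0 j :> 'rV[R]_n.
    by rewrite linearD linearZ/= !trmx_delta.
  rewrite !mulmxDl !mulmxDr.
  rewrite -!scalemxAl -!scalemxAr -!rowE -!colE !mxE sij; ring.
have := pM (delta_mx i 0 + 1 *: delta_mx j 0).
have := pM (delta_mx i 0 + (-1) *: delta_mx j 0).
rewrite -!/(qform _ _) !e ler_norml.
by have /andP[? ?] := diag i; have /andP[? ?] := diag j; lra.
Qed.

End Loewner.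

(** * The risk parameter *)

Section Risk.
Context {R : realType}.

Lemma pdmx_drsubmx n k (N : 'M[R]_(n + k)) : pdmx N -> pdmx (drsubmx N).
Proof.
move=> [sN pN]; split; first by rewrite trmx_drsub sN.
move=> x x0; have := pN (col_mx 0 x); rewrite col_mx_eq0 (negPf x0) andbF.
move=> /(_ isT); rewrite -[N in X in X -> _]submxK tr_col_mx mul_row_block mul_row_col.
by rewrite trmx0 !mul0mx mulmx0 !add0r.
Qed.

(** Induction by Schur complement: [det N = s det D], where [s] is the complement of the lower right
    block [D] and [0 < s <= N_00]. *)
Lemma det_pdmx_hadamard n (N : 'M[R]_n) : pdmx N -> 0 < \det N <= \prod_i N i i.
Proof.
elim: n N => [|n IHn] N pN; first by rewrite det_mx00 big_ord0 ltr01 lexx.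
pose N1 : 'M[R]_(1 + n) := N; have pD := @pdmx_drsubmx 1 n N1 pN.
have uD := pdmx_unit pD; have [sN pos] := pN.
set a := N 0 0; pose r : 'rV[R]_n := ursubmx N1; pose D := drsubmx N1.
have defN : N1 = block_mx a%:M r r^T D.
  rewrite -[LHS]submxK; congr block_mx.
    by apply/matrixP => i j; rewrite !ord1 !mxE /= /a; congr (N _ _); apply/val_inj.
  by rewrite /r trmx_ursub [N1^T]sN.
pose s := a - (r *m invmx D *m r^T) 0 0.
pose K : 'M[R]_(1 + n) := block_mx 1%:M 0 (- (invmx D *m r^T)) 1%:M.
have NK : N1 *m K = block_mx s%:M r 0 D.
  rewrite defN mulmx_block !mulmx1 !mulmx0 !add0r !mulmxN mulmxA (mulmxA D).
  rewrite mulmxV// mul1mx subrr; congr block_mx.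
  by rewrite /s raddfB/= -mx11_scalar.
have detN : \det N = s * \det D.
  have := congr1 determinant NK; rewrite det_mulmx det_lblock det_ublock.
  by rewrite !det1 !mulr1 det_scalar expr1.
have sa : s <= a.
  rewrite /s lerBlDr lerDl.
  have := proj2 (pdmx_psd (pdmx_inv pD)) r^T.
  by rewrite trmxK.
(* [s] is the value of the quadratic form at the first column of [K]. *)
have s0 : 0 < s.
  pose x : 'cV[R]_(1 + n) := K *m col_mx 1%:M 0.
  have xE : x = col_mx 1%:M (- (invmx D *m r^T)).
    by rewrite /x mul_block_col !mulmx1 !mulmx0 !addr0.
  have x0 : x != 0 by rewrite xE col_mx_eq0 oner_eq0.
  have Nx : N1 *m x = col_mx s%:M 0.
    by rewrite /x mulmxA NK mul_block_col !mulmx1 !mulmx0 !addr0.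
  have xNx : x^T *m (N1 *m x) = s%:M.
    by rewrite Nx xE tr_col_mx mul_row_col mulmx0 addr0 trmx1 mul1mx.
  by have := pos x x0; rewrite -mulmxA [_ *m _]xNx mxE eqxx mulr1n.
have /andP[d0 dle] := IHn _ pD.
rewrite detN mulr_gt0//= big_ord_recl -/a.
rewrite ler_pM ?(ltW s0) ?(ltW d0)//.
apply: le_trans dle _; rewrite le_eqVlt; apply/orP; left; apply/eqP.
by apply: eq_bigr => i _; rewrite !mxE; congr (N _ _); apply/val_inj.
Qed.

(** Write [1 + v = (1 + u) (1 + w)] with [w = (v - u) / (1 + u)]; then
    [ln (1 + w) <= w <= v - u]. *)
Lemma sub_ln1D_le (u v : R) : 0 <= u -> u <= v ->
  u - ln (1 + u) <= v - ln (1 + v).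
Proof.
move=> u0 uv; have u1 : 0 < 1 + u by lra.
have v1 : 0 < 1 + v by lra.
have -> : 1 + v = (1 + u) * (1 + (v - u) / (1 + u)).
  by rewrite mulrDr mulr1 mulrC divfK ?gt_eqF//; lra.
have q0 : 0 <= (v - u) / (1 + u) by rewrite divr_ge0//; lra.
rewrite lnM ?posrE//; last by lra.
have h1 : ln (1 + (v - u) / (1 + u)) <= (v - u) / (1 + u).
  by apply: le_ln1Dx; lra.
have h2 : (v - u) / (1 + u) <= v - u by rewrite ler_pdivrMr// ler_peMr; lra.
lra.
Qed.

(** With [N = (1 - th P)^-1], [2 gamma = tr N - n - ln det N] dominates the sum of the nonnegative
    terms [N_ii - 1 - ln N_ii]. Only the term of index 0 is kept. *)
Lemma gamma_ge n (P : 'M[R]_n.+1) (th : R) : 0 < th -> pdmx P ->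
  pdmx (invmx P - th%:M) ->
  th * P 0 0 - ln (1 + th * P 0 0) <= 2 * gamma P th.
Proof.
move=> th0 pP h; have pS := pdmx_inv pP.
have pM : pdmx (1%:M - th *: P).
  have := @pdmx_dual _ _ _ th%:M (invmx P) 1%:M (pdmx_scalar n.+1 th0) pS.
  rewrite trmx1 !(mul1mx, mulmx1) invmxK invmx_scalar => /(_ h) /(pdmxZ th0).
  by rewrite scalerBr scale_scalar_mx divff ?gt_eqF.
set M := 1%:M - th *: P in pM *; have uM := pdmx_unit pM.
pose N := invmx M; have pN : pdmx N := pdmx_inv pM.
(* Neumann expansion with exact remainder; the remainder is positive semidefinite, whence
   [N_ii >= 1 + th P_ii]. *)
have NE : N = 1%:M + th *: P + th ^+ 2 *: (P *m N *m P^T).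
  rewrite (proj1 pP); have e1 : N = 1%:M + th *: (N *m P).
    by rewrite -[1%:M](mulVmx uM) -/N {1}/M mulmxBr mulmx1 -scalemxAr addrNK.
  have e2 : N = 1%:M + th *: (P *m N).
    by rewrite -[1%:M](mulmxV uM) -/N {1}/M mulmxBl mul1mx -scalemxAl addrNK.
  rewrite [LHS]e2 {1}e1 mulmxDr mulmx1 -scalemxAr scalerDr scalerA -expr2.
  by rewrite addrA mulmxA.
have P0 i : 0 <= P i i.
  by have := proj2 (pdmx_psd pP) (delta_mx i 0); rewrite -/(qform _ _) qform_delta.
have Nge i : 1 + th * P i i <= N i i.
  rewrite NE !mxE eqxx mulr1n lerDl mulr_ge0 ?sqr_ge0//.
  have := proj2 (psdmx_congr P (pdmx_psd pN)) (delta_mx i 0).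
  by rewrite -/(qform _ _) qform_delta mxE.
have /andP[dN0 dN] := det_pdmx_hadamard pN.
have trE : \tr N - n.+1%:R = \sum_i (N i i - 1).
  by rewrite sumrB sumr_const card_ord.
have detM : ln (\det M) = - ln (\det N).
  rewrite -[in RHS](lnV _) ?posrE// /N det_inv.
  by rewrite invrK.
rewrite /gamma -/M -/N detM mulrA mulfV ?pnatr_eq0// mul1r -addrA trE.
have u0 : 0 <= th * P 0 0 by rewrite mulr_ge0// ltW.
have uN : th * P 0 0 <= N 0 0 - 1 by rewrite lerBrDl Nge.
apply: le_trans (sub_ln1D_le u0 uN) _; rewrite addrC subrKC [leRHS]addrC.
rewrite big_ord_recl; set s := \sum_(_ < n) _.
suff : ln (\det N) <= ln (N 0 0) + s by lra.
have N0 i : 0 < N i i.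
  by apply: lt_le_trans (Nge i); rewrite ltr_pwDl// mulr_ge0// ltW.
(* The remaining factors satisfy [N_ii <= exp (N_ii - 1)]. *)
rewrite -[s]expRK -lnM ?posrE ?expR_gt0// ler_ln ?posrE ?mulr_gt0 ?expR_gt0//.
apply: le_trans dN _; rewrite big_ord_recl ler_wpM2l//; first exact: ltW.
rewrite expR_sum; apply: ler_prod => i _; rewrite ltW//=.
by have := expR_ge1Dx (N (lift ord0 i) (lift ord0 i) - 1); rewrite subrKC.
Qed.

Lemma risk_parameter_small n (b e : R) : 0 < b -> 0 < e ->
  exists2 c0 : R, 0 < c0 & forall c (P : 'M[R]_n.+1) th, c <= c0 ->
    0 < th -> pdmx P -> b <= P 0 0 -> pdmx (invmx P - th%:M) ->
    c = gamma P th -> th <= e.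
Proof.
move=> b0 e0; have eb0 : 0 < e * b by rewrite mulr_gt0.
have c0 : 0 < e * b - ln (1 + e * b).
  rewrite subr_gt0 -[ltRHS]expRK ltr_ln ?posrE ?expR_gt0//; last by lra.
  by rewrite expR_gt1Dx// gt_eqF.
(* With [f u = u - ln (1 + u)], a parameter [th > e] would give [f (e b) <= 2 c <= f (e b) / 2],
   which contradicts [f (e b) > 0]. *)
exists ((e * b - ln (1 + e * b)) / 4) => [|c P th cc th0 pP bP h cE].
  by rewrite divr_gt0.
rewrite leNgt; apply/negP => eth.
have le1 : e * b <= th * P 0 0 by rewrite ler_pM// ?ltW.
have := sub_ln1D_le (ltW eb0) le1; have := gamma_ge th0 pP h; rewrite -cE.
lra.
Qed.

End Risk.

(** * Limits of the robust filter *)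

Section MatrixLimits.
Context {R : realType} {T : Type} {F : set_system T} {FF : Filter F}.

Lemma cvg_mxP m n (f : T -> 'M[R]_(m, n)) (M : 'M[R]_(m, n)) :
  (forall i j, f t i j @[t --> F] --> M i j) -> f @ F --> M.
Proof.
move=> h; apply/cvgrPdist_le => e e0.
have : \forall t \near F, forall i j, `|M i j - f t i j| <= e.
  apply: filter_forall => i; apply: filter_forall => j.
  by have /cvgrPdist_le := h i j; apply.
apply: filterS => t ht; apply: mx_norm_le => [|i j]; first exact: ltW.
by rewrite !mxE.
Qed.

Lemma cvg_entry m n (f : T -> 'M[R]_(m, n)) (M : 'M[R]_(m, n)) i j :
  f @ F --> M -> f t i j @[t --> F] --> M i j.
Proof.
move=> h; apply: (cvg_comp f (fun N : 'M[R]_(m, n) => N i j) h).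
exact: coord_continuous.
Qed.

Lemma cvg_mulmx m n k (f : T -> 'M[R]_(m, n)) (g : T -> 'M[R]_(n, k))
    (M : 'M[R]_(m, n)) (N : 'M[R]_(n, k)) :
  f @ F --> M -> g @ F --> N -> f t *m g t @[t --> F] --> M *m N.
Proof.
move=> fM gN; apply: cvg_mxP => i j; rewrite mxE.
under eq_fun do rewrite mxE.
elim: (index_enum _) => [|a r IH].
  by rewrite big_nil; under eq_fun do rewrite big_nil; exact: cvg_cst.
rewrite big_cons [X in X @ F](_ : _ =
  (fun t => f t i a * g t a j + \sum_(l <- r) f t i l * g t l j)).
  by apply: cvgD => //; apply: cvgM; exact: cvg_entry.
by apply/funext => t; rewrite big_cons.
Qed.

Lemma cvg_trmx m n (f : T -> 'M[R]_(m, n)) (M : 'M[R]_(m, n)) :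
  f @ F --> M -> (f t)^T @[t --> F] --> M^T.
Proof.
move=> fM; apply: cvg_mxP => i j; rewrite mxE.
by under eq_fun do rewrite mxE; exact: cvg_entry.
Qed.

Lemma pdmx_cvg n (f : T -> 'M[R]_n) (M : 'M[R]_n) : f @ F --> M -> pdmx M ->
  \forall t \near F, (f t)^T = f t -> pdmx (f t).
Proof. by move=> fM pM; exact: (fM _ (pdmx_near pM)). Qed.

End MatrixLimits.

Lemma mx_norm_limit_le {R : realType} m n (f : nat -> 'M[R]_(m, n))
    (M : 'M[R]_(m, n)) (a : R) :
  f @ \oo --> M -> (forall k, `|f k| <= a) -> `|M| <= a.
Proof.
move=> fM fa; have h : `|f k| @[k --> \oo] --> `|M| by exact: cvg_norm.
rewrite -(cvg_lim _ h)//; apply: limr_le; first by apply/cvg_ex; exists `|M|.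
exact: nearW.
Qed.

Section FilterGain.
Context {R : realType} {n p : nat}.
Variables (A : 'M[R]_n) (B : 'M[R]_(n, n + p)) (C : 'M[R]_(p, n))
  (D : 'M[R]_(p, n + p)).
Hypotheses (hBD : B *m D^T = 0) (hinv : col_mx B D \in unitmx).

Lemma stacked_lker0 (x : 'rV[R]_n) (y : 'rV[R]_p) :
  x *m B + y *m D = 0 -> row_mx x y = 0.
Proof.
move=> h; rewrite -[row_mx x y](mulmxK hinv) mul_row_col h mul0mx//.
Qed.

(** If [x^T Bbar = 0], then [x^T B - x^T G D] is a vanishing combination of the rows of the
    invertible stacked matrix. *)
Lemma Bbar_gram_pd (G : 'M[R]_(n, p)) : pdmx (Bbar B D G *m (Bbar B D G)^T).
Proof.
apply: pdmx_gram_unit => x /(congr1 trmx).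
rewrite trmx_mul trmxK trmx0 /Bbar mulmxBr mulmxA -mulNmx => /stacked_lker0.
by move=> /eqP; rewrite row_mx_eq0 => /andP[/eqP/(congr1 trmx)]; rewrite trmxK trmx0.
Qed.

Lemma B_gram_pd : pdmx (B *m B^T).
Proof. by have := Bbar_gram_pd 0; rewrite /Bbar mul0mx subr0. Qed.

Lemma D_gram_pd : pdmx (D *m D^T).
Proof.
apply: pdmx_gram_unit => x /(congr1 trmx); rewrite trmx_mul trmxK trmx0 => h.
have : row_mx (0 : 'rV[R]_n) x^T = 0 by apply: stacked_lker0; rewrite mul0mx add0r.
by move=> /eqP; rewrite row_mx_eq0 => /andP[_ /eqP/(congr1 trmx)]; rewrite trmxK trmx0.
Qed.

Lemma innovation_pd V : pdmx V -> pdmx (C *m V *m C^T + D *m D^T).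
Proof.
move=> pV; rewrite addrC; apply: pdmxD; first exact: D_gram_pd.
exact/psdmx_congr/pdmx_psd.
Qed.

Lemma information_pd V : pdmx V ->
  pdmx (invmx V + C^T *m invmx (D *m D^T) *m C).
Proof.
move=> pV; apply: pdmxD; first exact: pdmx_inv.
by have := psdmx_congr C^T (pdmx_psd (pdmx_inv D_gram_pd)); rewrite trmxK.
Qed.

(** The matrix inversion lemma. With [R = D D^T] and [W] the innovation covariance, the cancellation
    rests on [R^-1 (W - R) W^-1 = R^-1 - W^-1]. *)
Lemma information_woodbury V : pdmx V ->
  invmx (invmx V + C^T *m invmx (D *m D^T) *m C) =
  V - V *m C^T *m invmx (C *m V *m C^T + D *m D^T) *m C *m V.
Proof.
move=> pV; have uV := pdmx_unit pV; have uR := pdmx_unit D_gram_pd.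
have uI := pdmx_unit (information_pd pV); have uW := pdmx_unit (innovation_pd pV).
set I := invmx V + _ in uI *; set W := C *m V *m C^T + _ in uW *.
set Rr := D *m D^T in uR I uI W uW *.
suff e : I *m (V - V *m C^T *m invmx W *m C *m V) = 1%:M.
  by rewrite -[RHS](mulKmx uI) e mulmx1.
have e : invmx Rr *m (C *m V *m C^T) *m invmx W = invmx Rr - invmx W.
  have -> : C *m V *m C^T = W - Rr by rewrite /W addrK.
  by rewrite mulmxBr mulVmx// mulmxBl mul1mx -mulmxA mulmxV// mulmx1.
rewrite /I mulmxBr !mulmxDl mulVmx// !mulmxA mulVmx// mul1mx.
have -> : C^T *m invmx Rr *m C *m V *m C^T *m invmx W *m C *m V =
    C^T *m (invmx Rr *m (C *m V *m C^T) *m invmx W) *m C *m V by rewrite !mulmxA.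
by rewrite e mulmxBr !mulmxBl subrKC addrK.
Qed.

Lemma joseph_expansion V (G : 'M[R]_(n, p)) :
  G *m (C *m V *m C^T + D *m D^T) = A *m V *m C^T ->
  Abar A C G *m V *m (Abar A C G)^T + Bbar B D G *m (Bbar B D G)^T =
  A *m V *m A^T - G *m C *m V *m A^T + B *m B^T.
Proof.
move=> GW; have hDB : D *m B^T = 0 by apply: trmx_inj; rewrite trmx_mul trmxK trmx0.
have AT : (Abar A C G)^T = A^T - C^T *m G^T by rewrite /Abar linearB/= trmx_mul.
have BT : (Bbar B D G)^T = B^T - D^T *m G^T by rewrite /Bbar linearB/= trmx_mul.
have eB : Bbar B D G *m (Bbar B D G)^T = B *m B^T + G *m (D *m D^T) *m G^T.
  rewrite BT /Bbar mulmxBr !mulmxBl !mulmxA hBD mul0mx -(mulmxA G D B^T) hDB.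
  by rewrite mulmx0 subr0 sub0r opprK.
have eA : Abar A C G *m V *m (Abar A C G)^T = A *m V *m A^T - G *m C *m V *m A^T
    - A *m V *m C^T *m G^T + G *m (C *m V *m C^T) *m G^T.
  by rewrite AT /Abar mulmxBr !mulmxBl !mulmxA opprB addrA addrAC.
rewrite eA eB -GW mulmxDr mulmxDl.
move: (A *m V *m A^T) (G *m C *m V *m A^T) (B *m B^T) => a b c.
move: (G *m (C *m V *m C^T) *m G^T) (G *m (D *m D^T) *m G^T) => d e.
apply/matrixP => i j; rewrite !mxE; lra.
Qed.

(** Joseph form: the update becomes the propagation of [V] through [Abar] plus noise. At a fixed
    point with [V = P] it is a Lyapunov equation for [Abar]. *)
Lemma riccati_joseph V G : pdmx V -> G = gain A C D V ->
  riccati A B C D (invmx V) =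
  Abar A C G *m V *m (Abar A C G)^T + Bbar B D G *m (Bbar B D G)^T.
Proof.
move=> pV GE; have uW := pdmx_unit (innovation_pd pV).
rewrite joseph_expansion; last by rewrite GE /gain mulmxKV.
by rewrite /riccati information_woodbury// mulmxBr mulmxBl GE /gain !mulmxA.
Qed.

End FilterGain.

Section SteadyState.
Context {R : realType} {n p : nat}.
Variables (A : 'M[R]_n) (B : 'M[R]_(n, n + p)) (C : 'M[R]_(p, n))
  (D : 'M[R]_(p, n + p)).
Hypotheses (hBD : B *m D^T = 0) (hinv : col_mx B D \in unitmx).

Lemma riccati_ge V : pdmx V -> psdmx (riccati A B C D (invmx V) - B *m B^T).
Proof.
move=> pV; rewrite /riccati addrK; apply: psdmx_congr.
exact/pdmx_psd/pdmx_inv/(information_pd C hinv).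
Qed.

Lemma riccati_pd V : pdmx V -> pdmx (riccati A B C D (invmx V)).
Proof.
move=> pV; rewrite -[riccati _ _ _ _ _](subrK (B *m B^T)) addrC.
by apply: pdmxD; [exact: B_gram_pd hinv | exact: riccati_ge].
Qed.

Lemma riccati_sym V : V^T = V ->
  (riccati A B C D (invmx V))^T = riccati A B C D (invmx V).
Proof.
move=> sV; rewrite /riccati linearD/= !trmx_mul !trmxK trmx_inv linearD/=.
by rewrite !trmx_mul !trmxK !trmx_inv trmx_mul trmxK sV !mulmxA.
Qed.

Lemma risk_var_inv (P : 'M[R]_n) th : pdmx (risk_var th P) ->
  pdmx (invmx P - th%:M).
Proof. by move=> /pdmx_inv; rewrite /risk_var invmxK. Qed.

Variables (c th : R) (P V : 'M[R]_n) (G : 'M[R]_(n, p)).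
Hypothesis ss : steady_state A B C D c th P V G.

(** [steady_state] supplies limits, and the relations among them are recovered here. The third part
    transfers to [th] any upper bound valid for all pairs with the properties that [P_(t+1)] and
    [th_t] have for large [t]; continuity of [gamma] is thus avoided. *)
Lemma steady_state_limits : [/\ V = risk_var th P, G = gain A C D V &
  forall e : R, (forall (P' : 'M[R]_n) th', 0 < th' -> pdmx P' ->
    psdmx (P' - B *m B^T) -> pdmx (invmx P' - th'%:M) -> c = gamma P' th' ->
    th' <= e) -> th <= e].
Proof.
have [+ [th0 pP pV] _ _] := ss.
move=> /(_ 1%:M (pdmx1 n))[Pt [Vt [Gt [tht [rf thl Pl Vl Gl]]]]].
have [[_ V0] GE PE thE VE] := rf.
(* Symmetry holds for every [t]; positivity is claimed only for large [t], from the positive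
   definite limit [V]. *)
have sV t : (Vt t)^T = Vt t.
  elim: t => [|t IH]; first by rewrite V0 trmx1.
  by rewrite VE /risk_var PE trmx_inv linearB/= trmx_inv riccati_sym// tr_scalar_mx.
have nV : \forall t \near \oo, pdmx (Vt t).
  by have := pdmx_cvg Vl pV; apply: filterS => t; apply.
have shift (T : ptopologicalType) (u : nat -> T) (l : T) :
    u @ \oo --> l -> u t.+1 @[t --> \oo] --> l.
  by move=> ul; have := cvg_shiftS u (nbhs l) => ->.
have nV1 : \forall t \near \oo, pdmx (Vt t.+1).
  by have := pdmx_cvg (shift _ _ _ Vl) pV; apply: filterS => t; apply.
have nP : \forall t \near \oo, pdmx (Pt t.+1) /\ psdmx (Pt t.+1 - B *m B^T).
  apply: filterS nV => t pVt; rewrite PE.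
  by split; [exact: riccati_pd | exact: riccati_ge].
(* [V^-1 = P^-1 - th] multiplied by [V] on the left and [P] on the right: without inverses, it
   passes to the limit through products. *)
have nrel : \forall t \near \oo, Pt t.+1 = Vt t.+1 - tht t *: (Vt t.+1 *m Pt t.+1).
  near=> t; have pVt : pdmx (Vt t.+1) by near: t.
  have [pPt _] : pdmx (Pt t.+1) /\ psdmx (Pt t.+1 - B *m B^T) by near: t.
  have uP := pdmx_unit pPt; have uV := pdmx_unit pVt.
  have := VE t; rewrite /risk_var => /(congr1 invmx); rewrite invmxK.
  move=> /(congr1 (fun M => Vt t.+1 *m M *m Pt t.+1)).
  rewrite mulmxV// mul1mx mulmxBr mulmxBl -!mulmxA mulVmx// mulmx1 => e.
  by rewrite {1}e mul_scalar_mx -scalemxAr.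
have uP := pdmx_unit pP; have uV := pdmx_unit pV.
have rel : P = V - th *: (V *m P).
  apply: (@norm_cvg_unique _ _ (Pt t.+1 @[t --> \oo])); first exact: shift.
  apply: (@cvg_trans _ (Vt t.+1 - tht t *: (Vt t.+1 *m Pt t.+1) @[t --> \oo])).
    apply: near_eq_cvg; apply: filterS nrel => t <-//.
  apply: cvgB; first exact: shift.
  by apply: cvgZ => //; apply: cvg_mulmx; exact: shift.
split.
- have e : V *m (invmx P - th%:M) = 1%:M.
    rewrite mulmxBr mul_mx_scalar {1}(_ : V = P + th *: (V *m P)); last first.
      by rewrite {1}rel subrK.
    by rewrite mulmxDl -scalemxAl mulmxK// mulmxV// addrK.
  have := congr1 (fun M => invmx V *m M) e; rewrite mulKmx// mulmx1 => h.
  by rewrite /risk_var h invmxK.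
- have uW := pdmx_unit (innovation_pd C hinv pV).
  suff e : G *m (C *m V *m C^T + D *m D^T) = A *m V *m C^T.
    by rewrite /gain -e mulmxK.
  apply: (@norm_cvg_unique _ _
    (Gt t *m (C *m Vt t *m C^T + D *m D^T) @[t --> \oo])).
    apply: cvg_mulmx => //; apply: cvgD; last exact: cvg_cst.
    by apply: cvg_mulmx; [apply: cvg_mulmx => //|]; exact: cvg_cst.
  apply: (@cvg_trans _ (A *m Vt t *m C^T @[t --> \oo])); last first.
    by apply: cvg_mulmx; [apply: cvg_mulmx => //|]; exact: cvg_cst.
  apply: near_eq_cvg; apply: filterS nV => t pVt.
  by rewrite GE /gain mulmxKV//; exact: (pdmx_unit (innovation_pd C hinv pVt)).
- move=> e he; rewrite -(cvg_lim _ thl)//; apply: limr_le.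
    by apply/cvg_ex; exists th.
  near=> t; have pVt : pdmx (Vt t.+1) by near: t.
  have [pPt gPt] : pdmx (Pt t.+1) /\ psdmx (Pt t.+1 - B *m B^T) by near: t.
  have [[tht0 _ cE] _] := thE t.
  by apply: he tht0 pPt gPt _ cE; apply: risk_var_inv; rewrite -VE.
Unshelve. all: by end_near. Qed.

End SteadyState.

(** * The backward recursion and the closed loop *)

Section BackwardRecursion.
Context {R : realType} {n m : nat}.

(* If [X_k <= tau Y] with [tau = th kap], then
   [X_k^-1 - Bb Bb^T >= (1 - eta) / tau Y^-1], hence
   [X_(k+1) <= tau (1 - 2 eta) / (1 - eta) Y + th <= tau (1 - eta) Y + th]. *)
Lemma X_seq_bound (th eta kap : R) (Ab : 'M[R]_n) (Bb : 'M[R]_(n, m)) Y k :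
  0 < th -> 0 < eta < 1 -> 0 < kap -> pdmx Y ->
  psdmx ((1 - 2 * eta) *: Y - Ab^T *m Y *m Ab) ->
  psdmx ((kap * eta) *: Y - 1%:M) ->
  psdmx ((eta / (th * kap)) *: invmx Y - Bb *m Bb^T) ->
  psdmx (X_seq th Ab Bb k - th%:M) /\
  psdmx ((th * kap) *: Y - X_seq th Ab Bb k).
Proof.
move=> th0 /andP[eta0 eta1] kap0 pY hA hK hB.
have tau0 : 0 < th * kap by rewrite mulr_gt0.
set tau := th * kap in hB tau0 *.
have hth : psdmx ((tau * eta) *: Y - th%:M).
  have := psdmxZ (ltW th0) hK; by rewrite scalerBr scalerA scalemx1 mulrA.
elim: k => [|k [lo hi]] /=.
  split; first by rewrite subrr; exact: psdmx0.
  have -> : tau *: Y - th%:M = ((tau * eta) *: Y - th%:M) + (tau * (1 - eta)) *: Y.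
    by rewrite mulrBr mulr1 scalerBl addrACA addrC addrA addrNK addrC.
  apply: psdmxD => //; apply: psdmxZ; last exact: pdmx_psd.
  by rewrite mulr_ge0 ?ltW// subr_gt0.
set X := X_seq th Ab Bb k in lo hi *.
have pX : pdmx X.
  by rewrite -[X](subrK th%:M) addrC; apply: pdmxD => //; exact: pdmx_scalar.
have ptY : pdmx (tau *: Y) := pdmxZ tau0 pY.
have iY : invmx (tau *: Y) = tau^-1 *: invmx Y.
  by rewrite invmxZ// pdmx_unit.
have hX := psdmx_invB pX ptY hi; rewrite iY in hX.
set I := invmx X - Bb *m Bb^T.
have gI : psdmx (I - ((1 - eta) / tau) *: invmx Y).
  have -> : I - ((1 - eta) / tau) *: invmx Y =
    (invmx X - tau^-1 *: invmx Y) + ((eta / tau) *: invmx Y - Bb *m Bb^T).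
    rewrite /I mulrBl mul1r scalerBl.
    move: (invmx X) (tau^-1 *: invmx Y) ((eta / tau) *: invmx Y) (Bb *m Bb^T).
    by move=> *; apply/matrixP => i j; rewrite !mxE; lra.
  exact: psdmxD.
have a0 : 0 < (1 - eta) / tau by rewrite divr_gt0// subr_gt0.
have piY : pdmx (((1 - eta) / tau) *: invmx Y) := pdmxZ a0 (pdmx_inv pY).
have pI : pdmx I.
  by rewrite -[I](subrK (((1 - eta) / tau) *: invmx Y)) addrC; apply: pdmxD.
have hW := psdmx_invB piY pI gI.
have uYi : invmx Y \in unitmx by rewrite unitmx_inv pdmx_unit.
rewrite invmxZ ?pdmx_unit// invmxK invfM invrK mulrC in hW.
have := psdmx_congr Ab^T hW; rewrite trmxK mulmxBr mulmxBl => hAW.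
split; first by rewrite addrK -{2}[Ab]trmxK; apply/psdmx_congr/pdmx_psd/pdmx_inv.
set W := Ab^T *m invmx I *m Ab in hAW *.
rewrite -scalemxAr -scalemxAl in hAW.
have := psdmxZ (_ : 0 <= tau / (1 - eta)) hA.
move=> /(_ (ltW (divr_gt0 tau0 _))); rewrite subr_gt0 => /(_ eta1) hA'.
(* The last summand is the slack [(1 - eta) - (1 - 2 eta) / (1 - eta) = eta^2 / (1 - eta)], times
   [tau]. *)
have -> : tau *: Y - (W + th%:M) = (tau / (1 - eta) *: (Ab^T *m Y *m Ab) - W) +
  (tau / (1 - eta)) *: ((1 - 2 * eta) *: Y - Ab^T *m Y *m Ab) +
  ((tau * eta) *: Y - th%:M) + (tau * eta ^+ 2 / (1 - eta)) *: Y.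
  rewrite scalerBr scalerA; move: (Ab^T *m Y *m Ab) => Q.
  by apply/matrixP => i j; rewrite !mxE; field; lra.
apply: psdmxD; last first.
  apply: psdmxZ; last exact: pdmx_psd.
  by rewrite divr_ge0 ?mulr_ge0 ?sqr_ge0 ?ltW// subr_gt0.
by apply: psdmxD => //; apply: psdmxD.
Qed.

(** The constants depend only on [Ab0], [Bb0] and [Z]. The inequalities that involve the pair are
    arranged to be strict at the limit, so they persist nearby and the bound is uniform in [k], in
    small [th] and in the pair. *)
Lemma X_seq_small (Ab0 Z : 'M[R]_n) (Bb0 : 'M[R]_(n, m)) :
  pdmx Z -> pdmx (Z - Ab0 *m Z *m Ab0^T) ->
  exists K e : R, [/\ 0 <= K, 0 < e &
    \forall AB \near (Ab0, Bb0), forall th k, 0 < th <= e ->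
      `|X_seq th AB.1 AB.2 k| <= K * th].
Proof.
move=> pZ hZ; pose Y := invmx Z; have pY : pdmx Y := pdmx_inv pZ.
have pQ : pdmx (Y - Ab0^T *m Y *m Ab0).
  have := @pdmx_dual _ _ _ Z Z Ab0^T pZ pZ; rewrite trmxK; exact.
have [a a0 ha] := psdmx_le_scale pQ (proj1 pY).
(* Then [1 - 2 eta = a / (a + 1)]: as [a Q >= Y] for [Q = Y - Ab0^T Y Ab0], removing [Y / (a + 1)]
   from [Q] leaves a positive definite matrix. *)
pose eta := ((a + 1) * 2)^-1.
have eta0 : 0 < eta by rewrite invr_gt0; lra.
have eta1 : eta < 1 by rewrite invf_lt1; lra.
have pQ1 : pdmx ((1 - 2 * eta) *: Y - Ab0^T *m Y *m Ab0).
  have -> : (1 - 2 * eta) *: Y - Ab0^T *m Y *m Ab0 = (a + 1)^-1 *: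
    ((Y - Ab0^T *m Y *m Ab0) + (a *: (Y - Ab0^T *m Y *m Ab0) - Y)).
    move: (Ab0^T *m Y *m Ab0) => Q; apply/matrixP => i j.
    by rewrite /eta !mxE; field; lra.
  by apply: pdmxZ; [rewrite invr_gt0; lra | exact: pdmxD].
have [k1 k10 hk1] := psdmx_le_scale pY (trmx1 R n).
pose kap := k1 / eta; have kap0 : 0 < kap by rewrite divr_gt0.
have [b b0 hb] := psdmx_le_scale (pdmx_inv pY) (proj1 (psdmx_gram Bb0)).
have pB : pdmx ((b + 1) *: invmx Y - Bb0 *m Bb0^T).
  by rewrite scalerDl scale1r addrAC addrC; apply: pdmxD => //; exact: pdmx_inv.
pose y := `|Y| *+ n.
have hy : psdmx (y%:M - Y) by apply: psdmx_scalarB => //; exact: (proj1 pY).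
have y0 : 0 <= y by rewrite mulrn_wge0.
(* [Y <= y] turns the bound [th kap Y] into a multiple of [th], and [th <= e] says exactly that
   [b + 1 <= eta / (th kap)]. *)
exists (kap * y), (eta / (kap * (b + 1))); split.
- by rewrite mulr_ge0// ltW.
- by rewrite divr_gt0// mulr_gt0//; lra.
have cA : (fun AB : 'M[R]_n * 'M[R]_(n, m) => AB.1) @ (Ab0, Bb0) --> Ab0.
  exact: cvg_fst.
have cB : (fun AB : 'M[R]_n * 'M[R]_(n, m) => AB.2) @ (Ab0, Bb0) --> Bb0.
  exact: cvg_snd.
have nA : \forall AB \near (Ab0, Bb0),
    pdmx ((1 - 2 * eta) *: Y - AB.1^T *m Y *m AB.1).
  have /pdmx_cvg/(_ pQ1) : (1 - 2 * eta) *: Y - AB.1^T *m Y *m AB.1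
      @[AB --> (Ab0, Bb0)] --> (1 - 2 * eta) *: Y - Ab0^T *m Y *m Ab0.
    apply: cvgB; first exact: cvg_cst.
    apply: cvg_mulmx => //; apply: cvg_mulmx; last exact: cvg_cst.
    exact: cvg_trmx.
  apply: filterS => AB; apply; rewrite linearB linearZ/= !trmx_mul trmxK.
  by rewrite (proj1 pY) mulmxA.
have nB : \forall AB \near (Ab0, Bb0),
    pdmx ((b + 1) *: invmx Y - AB.2 *m AB.2^T).
  have /pdmx_cvg/(_ pB) : (b + 1) *: invmx Y - AB.2 *m AB.2^T
      @[AB --> (Ab0, Bb0)] --> (b + 1) *: invmx Y - Bb0 *m Bb0^T.
    apply: cvgB; first exact: cvg_cst.
    by apply: cvg_mulmx => //; exact: cvg_trmx.
  apply: filterS => AB; apply; rewrite linearB linearZ/= trmx_mul trmxK.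
  by rewrite (proj1 (pdmx_inv pY)).
apply: filterS2 nA nB => -[Ab Bb] /= hA hB th k /andP[th0 the].
have tk0 : 0 < th * kap by rewrite mulr_gt0.
have hK : psdmx ((kap * eta) *: Y - 1%:M) by rewrite /kap divfK ?gt_eqF.
have hB' : psdmx ((eta / (th * kap)) *: invmx Y - Bb *m Bb^T).
  have -> : (eta / (th * kap)) *: invmx Y - Bb *m Bb^T =
    (eta / (th * kap) - (b + 1)) *: invmx Y + ((b + 1) *: invmx Y - Bb *m Bb^T).
    by rewrite scalerBl addrA subrK.
  apply: psdmxD; last exact: pdmx_psd.
  apply: psdmxZ; last exact/pdmx_psd/pdmx_inv.
  rewrite subr_ge0 ler_pdivlMr// mulrC -ler_pdivlMr; last by lra.
  by rewrite -ler_pdivlMr// -mulrA -invfM (mulrC (b + 1)).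
have eta01 : 0 < eta < 1 by rewrite eta0.
have [lo hi] := @X_seq_bound th eta kap Ab Bb Y k th0 eta01 kap0 pY
  (pdmx_psd hA) hK hB'.
apply: mx_norm_le => [|i j]; first by rewrite mulr_ge0 ?(ltW th0)// mulr_ge0// ltW.
have -> : kap * y * th = th * kap * y by ring.
apply: psdmx_entry_le.
  rewrite -[X_seq _ _ _ _](subrK th%:M); apply: psdmxD => //.
  exact/psdmx_scalar/ltW.
have -> : (th * kap * y)%:M - X_seq th Ab Bb k =
    ((th * kap) *: Y - X_seq th Ab Bb k) + (th * kap) *: (y%:M - Y).
  by rewrite scalerBr scale_scalar_mx [RHS]addrAC subrKC.
by apply: psdmxD => //; apply: psdmxZ => //; exact: ltW.
Qed.

(** Push-through identity: [(1 - Bb Bb^T X) Bb = Bb (1 - Bb^T X Bb)], and [Ktilde] cancels the last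
    factor. *)
Lemma closed_loop_eq (Ab X : 'M[R]_n) (Bb : 'M[R]_(n, m)) :
  1%:M - Bb^T *m X *m Bb \in unitmx ->
  (1%:M - Bb *m Bb^T *m X) *m (Ab + Bb *m Hmx Ab Bb X) = Ab.
Proof.
move=> uK; rewrite /Hmx; set K := Ktilde Bb X.
have e : (1%:M - Bb *m Bb^T *m X) *m (Bb *m K) = Bb.
  have -> : (1%:M - Bb *m Bb^T *m X) *m (Bb *m K) =
      Bb *m K - Bb *m ((Bb^T *m X *m Bb) *m K).
    by rewrite mulmxBl mul1mx !mulmxA.
  by rewrite -mulmxBr -{1}[K]mul1mx -mulmxBl mulmxV// mulmx1.
have -> : Bb *m (K *m Bb^T *m X *m Ab) = Bb *m K *m (Bb^T *m X *m Ab).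
  by rewrite !mulmxA.
by rewrite mulmxDr (mulmxA _ (Bb *m K)) e mulmxBl mul1mx !mulmxA subrK.
Qed.

(* With [U = 1 - Bb Bb^T X], the closed-loop matrix is [U^-1 Ab], so the
   Lyapunov inequality amounts to [U Z U^T - Ab Z Ab^T > 0], which is open. *)
Lemma closed_loop_lyapunov (Ab0 Z : 'M[R]_n) (Bb0 : 'M[R]_(n, m)) :
  pdmx Z -> pdmx (Z - Ab0 *m Z *m Ab0^T) ->
  \forall ABX \near ((Ab0, Bb0), 0 : 'M[R]_n), ABX.2^T = ABX.2 ->
    let Aw := ABX.1.1 + ABX.1.2 *m Hmx ABX.1.1 ABX.1.2 ABX.2 in
    pdmx (Z - Aw *m Z *m Aw^T).
Proof.
move=> pZ hZ; pose F := nbhs (Ab0, Bb0, 0 : 'M[R]_n).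
have cA : (fun a : 'M[R]_n * 'M[R]_(n, m) * 'M[R]_n => a.1.1) @ F --> Ab0.
  by apply: (cvg_comp fst fst cvg_fst); exact: cvg_fst.
have cB : (fun a : 'M[R]_n * 'M[R]_(n, m) * 'M[R]_n => a.1.2) @ F --> Bb0.
  by apply: (cvg_comp fst snd cvg_fst); exact: cvg_snd.
have cX : (fun a : 'M[R]_n * 'M[R]_(n, m) * 'M[R]_n => a.2) @ F --> (0 : 'M[R]_n).
  exact: cvg_snd.
have cU : 1%:M - a.1.2 *m a.1.2^T *m a.2 @[a --> F] --> (1%:M : 'M[R]_n).
  rewrite -[X in _ --> X](subr0 1%:M) -(mulmx0 _ (Bb0 *m Bb0^T)).
  apply: cvgB; first exact: cvg_cst.
  by apply: cvg_mulmx => //; apply: cvg_mulmx => //; exact: cvg_trmx.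
have nK : \forall a \near F, (1%:M - a.1.2^T *m a.2 *m a.1.2)^T =
    1%:M - a.1.2^T *m a.2 *m a.1.2 -> pdmx (1%:M - a.1.2^T *m a.2 *m a.1.2).
  have : 1%:M - a.1.2^T *m a.2 *m a.1.2 @[a --> F] --> (1%:M : 'M[R]_m).
    rewrite -[X in _ --> X](subr0 1%:M) -(mul0mx _ Bb0) -(mulmx0 _ Bb0^T).
    apply: cvgB; first exact: cvg_cst.
    by apply: cvg_mulmx => //; apply: cvg_mulmx => //; exact: cvg_trmx.
  by move=> /pdmx_cvg; apply; exact: pdmx1.
pose L (a : 'M[R]_n * 'M[R]_(n, m) * 'M[R]_n) :=
  let U := 1%:M - a.1.2 *m a.1.2^T *m a.2 in
  U *m Z *m U^T - a.1.1 *m Z *m a.1.1^T.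
have nL : \forall a \near F, (L a)^T = L a -> pdmx (L a).
  have : L @ F --> (Z - Ab0 *m Z *m Ab0^T).
    have -> : Z - Ab0 *m Z *m Ab0^T =
        1%:M *m Z *m 1%:M^T - Ab0 *m Z *m Ab0^T by rewrite trmx1 mul1mx mulmx1.
    apply: cvgB; (apply: cvg_mulmx; last exact: cvg_trmx);
      by apply: cvg_mulmx => //; exact: cvg_cst.
  by move=> /pdmx_cvg; exact.
apply: filterS2 nK nL => -[[Ab Bb] X] /= hK hL sX.
have {}hK : pdmx (1%:M - Bb^T *m X *m Bb).
  by apply: hK; rewrite linearB/= trmx1 !trmx_mul trmxK sX mulmxA.
have {}hL : pdmx (L (Ab, Bb, X)).
  apply: hL; rewrite /L linearB/= !trmx_mul !trmxK (proj1 pZ) !mulmxA//.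
set Aw := Ab + _; set U := 1%:M - Bb *m Bb^T *m X.
have UAw : U *m Aw = Ab := closed_loop_eq Ab (pdmx_unit hK).
have uU : U \in unitmx.
  (* The same identity with [Ab = 1] exhibits an inverse of [U]. *)
  suff /mulmx1_unit[] : U *m (1%:M + Bb *m Hmx 1%:M Bb X) = 1%:M by [].
  exact: closed_loop_eq (pdmx_unit hK).
have uUi : invmx U \in unitmx by rewrite unitmx_inv.
have := pdmx_congr uUi hL; rewrite /L/= -/U -UAw trmx_mul trmx_inv.
clearbody U Aw; have -> : U *m Z *m U^T - U *m Aw *m Z *m (Aw^T *m U^T) =
  U *m ((Z - Aw *m Z *m Aw^T) *m U^T) by rewrite mulmxBl mulmxBr !mulmxA.
by rewrite mulKmx// mulmxK ?unitmx_tr.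
Qed.

End BackwardRecursion.

(** * Spectral radius and Lyapunov inequalities *)

Section Stability.
Context {R : realType}.
Local Notation RC := (real_complex R).

Definition modulus (z : R[i]) : R := complex.Re `|z|.

Lemma modulusE z : `|z| = RC (modulus z).
Proof. by rewrite /modulus normc_def. Qed.

Lemma modulus_ge0 z : 0 <= modulus z.
Proof. by have := normr_ge0 z; rewrite modulusE -[0](rmorph0 RC) lecR. Qed.

Lemma modulusD z w : modulus (z + w) <= modulus z + modulus w.
Proof.
rewrite -lecR -modulusE (_ : RC (_ + _) = `|z| + `|w|) ?ler_normD//.
by rewrite !modulusE rmorphD.
Qed.

Lemma modulusM z w : modulus (z * w) = modulus z * modulus w.
Proof.
by apply: (@complexI R); rewrite -modulusE normrM !modulusE rmorphM.
Qed.

Lemma modulus_real (x : R) : modulus (RC x) = `|x|.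
Proof. by rewrite /modulus normc_def/= expr0n/= addr0 sqrtr_sqr. Qed.

(** The rate [s] lies strictly above [q] and [r], so the forcing is absorbed by [D / (s - q)] even
    when [q = r]. Repeated eigenvalues therefore cause no polynomial factors. *)
Lemma geometric_driven (q r D E : R) : 0 <= q < 1 -> 0 <= r < 1 -> 0 <= D ->
    0 <= E ->
  exists D' r' : R, [/\ 0 <= D', 0 <= r' < 1 & forall a : nat -> R,
    a 0%N <= E -> (forall k, a k.+1 <= q * a k + D * r ^+ k) ->
    forall k, a k <= D' * r' ^+ k].
Proof.
move=> /andP[q0 q1] /andP[r0 r1] D0 E0.
pose s := (1 + Num.max q r) / 2.
have m1 : Num.max q r < 1 by rewrite gt_max q1.
have qm : q <= Num.max q r by rewrite le_max lexx.
have rm : r <= Num.max q r by rewrite le_max lexx orbT.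
have s1 : s < 1 by rewrite /s; lra.
have qs : 0 < s - q by rewrite /s; lra.
have rs : r <= s by rewrite /s; lra.
have s0 : 0 <= s by apply: le_trans rs.
exists (E + D / (s - q)), s; split.
- by rewrite addr_ge0// divr_ge0// ltW.
- by rewrite s0.
- move=> a a0 ha; elim=> [|k IH].
    by rewrite expr0 mulr1; apply: (le_trans a0); rewrite lerDl divr_ge0// ltW.
  apply: (le_trans (ha k)).
  have h1 : q * a k <= q * ((E + D / (s - q)) * s ^+ k) by rewrite ler_wpM2l.
  have h2 : D * r ^+ k <= D * s ^+ k by rewrite ler_wpM2l// lerXn2r.
  apply: (le_trans (lerD h1 h2)); rewrite mulrA -mulrDl exprSr.
  rewrite [q * (_ + _)]mulrC (mulrC (s ^+ k)) mulrA ler_wpM2r ?exprn_ge0//.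
  rewrite -lerBrDl -mulrBr.
  by rewrite mulrDl divfK ?gt_eqF// lerDr mulr_ge0// ltW.
Qed.

Definition geometric_decay n (x : nat -> 'cV[R[i]]_n) := exists D r : R,
  [/\ 0 <= D, 0 <= r < 1 & forall k i, modulus (x k i 0) <= D * r ^+ k].

(** The vectors [x_k = M^k u] satisfy [x_(k+1) = l x_k + M^k (M - l) u], a driven scalar recursion
    in each coordinate. *)
Lemma geometric_decay_step n (M : 'M[R[i]]_n) (l : R[i]) u : modulus l < 1 ->
  geometric_decay (fun k => M ^+ k *m ((M - l%:M) *m u)) ->
  geometric_decay (fun k => M ^+ k *m u).
Proof.
move=> l1 [D [r [D0 r01 h]]].
pose E := \sum_i modulus (u i 0).
have E0 : 0 <= E by apply: sumr_ge0 => i _; exact: modulus_ge0.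
have ui i : modulus (u i 0) <= E.
  by rewrite /E (bigD1 i)//= lerDl sumr_ge0// => j _; exact: modulus_ge0.
have l01 : 0 <= modulus l < 1 by rewrite modulus_ge0.
have [D' [r' [D'0 r'01 hD]]] := geometric_driven l01 r01 D0 E0.
exists D', r'; split=> // k i; apply: (hD (fun k => modulus ((M ^+ k *m u) i 0))).
  by rewrite expr0 mul1mx.
move=> {}k; apply: (le_trans _ (lerD (lexx _) (h k i))).
rewrite -modulusM; apply: le_trans (modulusD _ _).
suff -> : M ^+ k.+1 *m u = l *: (M ^+ k *m u) + M ^+ k *m ((M - l%:M) *m u).
  by rewrite mxE [in X in X + _]mxE.
rewrite mulmxBl mulmxBr mul_scalar_mx -scalemxAr addrC subrK mulmxA.
by rewrite -[M ^+ k *m M]/(M ^+ k * M) -exprSr.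
Qed.

(** Peeling off the linear factors of an annihilating polynomial one by one takes the place of the
    Jordan form. *)
Lemma geometric_decay_annihilated n (M : 'M[R[i]]_n.+1) (s : seq R[i]) u :
  (forall l, l \in s -> modulus l < 1) ->
  horner_mx M (\prod_(l <- s) ('X - l%:P)) *m u = 0 ->
  geometric_decay (fun k => M ^+ k *m u).
Proof.
elim: s u => [|l s IH] u hs.
  rewrite big_nil rmorph1 mul1mx => ->; exists 0, 0.
  split=> //; first by rewrite lexx ltr01.
  by move=> k i; rewrite mulmx0 mxE mul0r /modulus normr0.
rewrite big_cons mulrC rmorphM/= -mulmxA => h.
apply: (@geometric_decay_step _ _ l); first by apply: hs; rewrite mem_head.
apply: IH => [l' l's|]; first by apply: hs; rewrite inE l's orbT.
by move: h; rewrite rmorphB/= horner_mx_X horner_mx_C.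
Qed.

Lemma stable_eigenvalue n (M : 'M[R]_n) l : stable M ->
  eigenvalue (map_mx (real_complex R) M) l -> modulus l < 1.
Proof.
move=> sM el; apply: le_lt_trans sM; apply: ub_le_sup; last by exists l.
(* The supremum dominates an eigenvalue only if the set is bounded above; the sum of the moduli of
   all characteristic roots is a bound. *)
have [s sE] := closed_field_poly_normal (char_poly (map_mx (real_complex R) M)).
exists (\sum_(z <- s) modulus z) => _ [z /= ez <-].
have : z \in s.
  move: ez; rewrite eigenvalue_root_char sE rootZ ?root_prod_XsubC//.
  by rewrite (monicP (char_poly_monic _)) oner_eq0.
move=> zs; rewrite -/(modulus z) (big_rem z)//= lerDl sumr_ge0// => w _.
exact: modulus_ge0.
Qed.

Lemma stable_powers n (M : 'M[R]_n.+1) (e : R) : stable M -> 0 < e ->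
  exists2 K, (0 < K)%N & `|M ^+ K| <= e.
Proof.
move=> sM e0; pose Mc := map_mx (real_complex R) M.
have [s sE] := closed_field_poly_normal (char_poly Mc).
have lc1 : lead_coef (char_poly Mc) = 1 := monicP (char_poly_monic _).
have hs l : l \in s -> modulus l < 1.
  move=> ls; apply: (stable_eigenvalue sM).
  by rewrite eigenvalue_root_char -/Mc sE lc1 scale1r root_prod_XsubC.
have hM : horner_mx Mc (\prod_(l <- s) ('X - l%:P)) = 0.
  by rewrite -[X in horner_mx _ X]scale1r -lc1 -sE Cayley_Hamilton.
have dec j : \forall k \near \oo, forall i, `|(M ^+ k) i j| <= e.
  have [||D [r [D0 /andP[r0 r1] h]]] :=
    @geometric_decay_annihilated _ Mc s (delta_mx j 0); rewrite ?hM ?mul0mx//.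
  have : D * r ^+ k @[k --> \oo] --> D * 0.
    apply: cvgM; first exact: cvg_cst.
    by apply: cvg_expr; rewrite ger0_norm.
  rewrite mulr0 => /cvgr_le /(_ e e0); apply: filterS => k hk i.
  apply: le_trans hk; apply: le_trans (h k i).
  by rewrite -colE mxE -rmorphXn/= mxE modulus_real.
have : \forall k \near \oo, forall j i, `|(M ^+ k) i j| <= e.
  exact: filter_forall dec.
case=> N _ hN; exists N.+1 => //; apply: mx_norm_le; first exact: ltW.
by move=> i j; apply: hN => /=.
Qed.

(** A truncated Gramian suffices: for [Z = sum_(j < K) M^j (M^j)^T] the difference telescopes to
    [1 - M^K (M^K)^T]. The term [j = 0] makes [Z] positive definite, which is why [K > 0] is
    required. *)
Lemma stable_lyapunov n (M : 'M[R]_n) : stable M ->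
  exists2 Z, pdmx Z & pdmx (Z - M *m Z *m M^T).
Proof.
case: n M => [|n] M sM.
  exists 1%:M; first exact: pdmx1.
  by split=> [|x]; [apply/matrixP => -[] | rewrite (flatmx0 x) eqxx].
(* If the entries of [M^K] are at most this [e], those of [M^K (M^K)^T] are at most
   [(n + 1) e^2 <= e], and [(n + 1) e = 1/2]. *)
have e0 : (0 : R) < (2 * n.+1%:R)^-1 by rewrite invr_gt0 mulr_gt0// ltr0n.
have [K K0 hK] := stable_powers sM e0.
pose Z k := \sum_(j < k) M ^+ j *m (M ^+ j)^T.
have ZK : Z K - M *m Z K *m M^T = 1%:M - M ^+ K *m (M ^+ K)^T.
  elim: (K) => [|k IH].
    by rewrite /Z big_ord0 mulmx0 mul0mx expr0 trmx1 mulmx1 subrr subrr.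
  rewrite /Z big_ord_recr/= -/(Z k) mulmxDr mulmxDl opprD addrACA IH.
  have -> : M *m (M ^+ k *m (M ^+ k)^T) *m M^T = M ^+ k.+1 *m (M ^+ k.+1)^T.
    by rewrite exprS trmx_mul !mulmxA.
  by rewrite addrA subrK.
exists (Z K).
  case: K K0 {hK ZK} => // K _; elim: K => [|k IH].
    by rewrite /Z big_ord1 expr0 trmx1 mulmx1; exact: pdmx1.
  by rewrite /Z big_ord_recr/=; apply: pdmxD => //; exact: psdmx_gram.
rewrite ZK; have -> : 1%:M - M ^+ K *m (M ^+ K)^T =
    (2^-1)%:M + ((2^-1)%:M - M ^+ K *m (M ^+ K)^T) :> 'M[R]_n.+1.
  rewrite addrA -raddfD/=; congr (_%:M - _); lra.
apply: pdmxD; first by apply: pdmx_scalar; rewrite invr_gt0.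
apply: psdmx_scalarB; first exact: (proj1 (psdmx_gram _)).
have -> : 2^-1 = (2 * n.+1%:R)^-1 *+ n.+1 :> R.
  by rewrite -[RHS]mulr_natr invfM mulfVK ?pnatr_eq0.
rewrite lerMn2r/=; apply: mx_norm_le => [|i j]; first exact: ltW.
rewrite mxE; apply: (le_trans (ler_norm_sum _ _ _)).
have h k l : `|(M ^+ K) k l| <= (2 * n.+1%:R)^-1.
  exact: le_trans (mx_norm_entry _ _ _) hK.
apply: (@le_trans _ _ (\sum_(k < n.+1) (2 * n.+1%:R)^-1 * (2 * n.+1%:R)^-1)).
  by apply: ler_sum => k _; rewrite normrM mxE ler_pM.
rewrite sumr_const card_ord -[_ *+ n.+1]mulr_natr -mulrA ler_piMr ?(ltW e0)//.
by rewrite invfM mulfVK ?pnatr_eq0// invf_le1// ler1n.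
Qed.

Lemma pdmx_block_diag n k (S : 'M[R]_n) (T : 'M[R]_k) :
  pdmx S -> pdmx T -> pdmx (block_mx S 0 0 T).
Proof.
move=> pS pT; split; first by rewrite tr_block_mx (proj1 pS) (proj1 pT) !trmx0.
move=> x; rewrite -[x]vsubmxK col_mx_eq0 negb_and.
set u := usubmx x; set v := dsubmx x.
rewrite tr_col_mx mul_row_block mul_row_col !mulmx0 addr0 add0r mxE.
have hu := proj2 (pdmx_psd pS) u; have hv := proj2 (pdmx_psd pT) v.
by case/orP => [/(proj2 pS)|/(proj2 pT)] h; [rewrite ltr_wpDr | rewrite ltr_wpDl].
Qed.

Lemma pdmx_schur n k (S : 'M[R]_n) (N : 'M[R]_(n, k)) (T : 'M[R]_k) :
  pdmx T -> pdmx (S - N *m invmx T *m N^T) -> pdmx (block_mx S N N^T T).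
Proof.
move=> pT pS; have uT := pdmx_unit pT.
pose K : 'M[R]_(n + k) := block_mx 1%:M (N *m invmx T) 0 1%:M.
have uK : K \in unitmx by rewrite unitmxE det_ublock !det1 mulr1 unitr1.
have := pdmx_congr uK (pdmx_block_diag pS pT).
rewrite /K tr_block_mx !mulmx_block !trmx1 !trmx0.
rewrite !(mul0mx, mulmx0, mul1mx, mulmx1, add0r, addr0).
by rewrite trmx_mul trmx_inv (proj1 pT) mulmxKV// (mulKVmx uT) mulmxA subrK.
Qed.

(** The first diagonal block gets a weight [s + 1] so large that its strict decrease dominates [a],
    which collects the coupling through [N] and the Schur complement correction. *)
Lemma block_lyapunov n k (F1 : 'M[R]_n) (F2 : 'M[R]_k) (N : 'M[R]_(n, k)) Z1 Z2 :
  pdmx Z1 -> pdmx (Z1 - F1 *m Z1 *m F1^T) ->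
  pdmx Z2 -> pdmx (Z2 - F2 *m Z2 *m F2^T) ->
  exists2 Z, pdmx Z & let F := block_mx F1 N 0 F2 in pdmx (Z - F *m Z *m F^T).
Proof.
move=> pZ1 pQ1 pZ2 pQ2; pose b := - (N *m Z2 *m F2^T).
set Q2 := Z2 - _ in pQ2; pose a := N *m Z2 *m N^T + b *m invmx Q2 *m b^T.
have sa : a^T = a.
  rewrite /a linearD/= !trmx_mul !trmxK trmx_inv (proj1 pZ2) (proj1 pQ2).
  by rewrite !mulmxA.
have [s s0 hs] := psdmx_le_scale pQ1 sa.
exists (block_mx ((s + 1) *: Z1) 0 0 Z2) => /=.
  by apply: pdmx_block_diag => //; apply: pdmxZ => //; rewrite ltr_wpDl// ltW.
rewrite tr_block_mx !mulmx_block !trmx0.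
rewrite !(mul0mx, mulmx0, add0r, addr0) opp_block_mx add_block_mx !add0r -/Q2.
have -> : - (F2 *m Z2 *m N^T) = b^T.
  by rewrite /b linearN/= !trmx_mul trmxK (proj1 pZ2) mulmxA.
apply: pdmx_schur => //.
have -> : (s + 1) *: Z1 - (F1 *m ((s + 1) *: Z1) *m F1^T + N *m Z2 *m N^T) -
   b *m invmx Q2 *m b^T = (Z1 - F1 *m Z1 *m F1^T) + (s *: (Z1 - F1 *m Z1 *m F1^T) - a).
  rewrite /a -scalemxAr -scalemxAl !scalerDl !scale1r scalerBr.
  move: (F1 *m Z1 *m F1^T) (N *m Z2 *m N^T) (b *m _ *m _) => x y z.
  apply/matrixP => i j; rewrite !mxE; lra.
exact: pdmxD.
Qed.

(* A discrete Lyapunov inequality absorbs bounded noise: [Pi <= s Z] is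
   preserved by [Pi |-> F_t Pi F_t^T + Q_t] once [F_t] is close to [F]. *)
Lemma lyapunov_bounded n (F Z : 'M[R]_n) (Ft Q Pi : nat -> 'M[R]_n) (q : R) :
  pdmx Z -> pdmx (Z - F *m Z *m F^T) -> Ft @ \oo --> F ->
  (forall t, psdmx (q%:M - Q t)) -> (forall t, psdmx (Pi t)) ->
  (forall t, Pi t.+1 = Ft t *m Pi t *m (Ft t)^T + Q t) ->
  exists b : R, forall t, `|Pi t| <= b.
Proof.
move=> pZ hF FtF hQ hPi PiE.
have [d d0 hd] := pdmx_ge_scalar hF.
have pd2 : pdmx (Z - F *m Z *m F^T - (d / 2)%:M).
  have -> : Z - F *m Z *m F^T - (d / 2)%:M =
      (d / 2)%:M + (Z - F *m Z *m F^T - d%:M).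
    by move: (F *m Z *m F^T) => x; apply/matrixP => i j; rewrite !mxE; lra.
  by apply: pdmxD => //; apply: pdmx_scalar; rewrite divr_gt0.
have : \forall t \near \oo, pdmx (Z - Ft t *m Z *m (Ft t)^T - (d / 2)%:M).
  have : Z - Ft t *m Z *m (Ft t)^T - (d / 2)%:M @[t --> \oo] -->
      Z - F *m Z *m F^T - (d / 2)%:M.
    apply: cvgB; last exact: cvg_cst.
    apply: cvgB; first exact: cvg_cst.
    apply: cvg_mulmx; last exact: cvg_trmx.
    by apply: cvg_mulmx => //; exact: cvg_cst.
  move=> /pdmx_cvg /(_ pd2); apply: filterS => t; apply.
  by rewrite !linearB/= !trmx_mul trmxK (proj1 pZ) tr_scalar_mx mulmxA.
case=> N _ hN.
have [s0 s00 hs0] := psdmx_le_scale pZ (proj1 (hPi N)).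
(* [s0] covers the starting time [N]; the second term gives [s d / 2 >= q], so the margin [d / 2]
   absorbs the noise. *)
pose s := s0 + `|q| * 2 / d.
have s_ge0 : 0 <= s.
  by rewrite addr_ge0 ?(ltW s00)// divr_ge0 ?mulr_ge0 ?(ltW d0).
have inv t : psdmx (s *: Z - Pi (t + N)%N).
  elim: t => [|t IH].
    rewrite add0n; have -> : s *: Z - Pi N =
        (s0 *: Z - Pi N) + (`|q| * 2 / d) *: Z by rewrite scalerDl addrAC.
    apply: psdmxD => //; apply: psdmxZ; last exact: pdmx_psd.
    by rewrite divr_ge0 ?mulr_ge0 ?(ltW d0).
  rewrite addSn PiE; set G := Ft _; set Q' := Q _; set P' := Pi _ in IH *.
  have -> : s *: Z - (G *m P' *m G^T + Q') =
     s *: (Z - G *m Z *m G^T - (d / 2)%:M) + G *m (s *: Z - P') *m G^T +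
     (q%:M - Q') + (s * (d / 2) - q)%:M.
    rewrite mulmxBr mulmxBl -scalemxAr -scalemxAl.
    move: (G *m Z *m G^T) (G *m P' *m G^T) => x y.
    apply/matrixP => i j; rewrite !mxE.
    by case: (i == j); rewrite ?mulr1n ?mulr0n; lra.
  apply: psdmxD; last first.
    apply: psdmx_scalar; rewrite subr_ge0 /s mulrDl.
    apply: (le_trans (ler_norm q)).
    have -> : `|q| * 2 / d * (d / 2) = `|q| by field; rewrite gt_eqF.
    by rewrite lerDr mulr_ge0 ?divr_ge0 ?(ltW d0) ?(ltW s00).
  apply: psdmxD; last exact: hQ.
  apply: psdmxD; last exact: psdmx_congr.
  by apply: psdmxZ => //; apply: pdmx_psd; apply: hN => /=; rewrite leq_addl.
pose b := s * (`|Z| *+ n) + \sum_(t < N) `|Pi t|.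
have tail t : `|Pi (t + N)%N| <= s * (`|Z| *+ n).
  apply: mx_norm_le => [|i j]; first by rewrite mulr_ge0// mulrn_wge0.
  apply: psdmx_entry_le => //.
  have -> : (s * (`|Z| *+ n))%:M - Pi (t + N)%N =
      (s *: Z - Pi (t + N)%N) + s *: ((`|Z| *+ n)%:M - Z).
    by rewrite scalerBr scale_scalar_mx [RHS]addrAC subrKC.
  apply: psdmxD => //; apply: psdmxZ => //.
  by apply: psdmx_scalarB => //; exact: (proj1 pZ).
exists b => t; have [tN|Nt] := ltnP t N.
  rewrite /b (bigD1 (Ordinal tN))//= addrCA lerDl addr_ge0//.
    by rewrite mulr_ge0// mulrn_wge0.
  exact: sumr_ge0.
by rewrite -(subnK Nt); apply: (le_trans (tail _)); rewrite lerDl sumr_ge0.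
Qed.

End Stability.

(** * Small tolerances *)

Section LeastFavorableLoop.
Context {R : realType} {n p : nat}.
Variables (A : 'M[R]_n) (B : 'M[R]_(n, n + p)) (C : 'M[R]_(p, n))
  (D : 'M[R]_(p, n + p)).
Hypotheses (hBD : B *m D^T = 0) (hinv : col_mx B D \in unitmx).

Lemma FmxE (G : 'M[R]_(n, p)) X Gp :
  let H := Hmx (Abar A C G) (Bbar B D G) X in
  Fmx A B C D G X Gp = block_mx (A - Gp *m C) ((B - Gp *m D) *m H) 0
    (Abar A C G + Bbar B D G *m H).
Proof.
rewrite /Fmx /Atilde /Ctilde mul_col_row !mul0mx opp_block_mx add_block_mx.
move: (Bbar B D G) (Hmx _ _ _) => Bb H.
by rewrite !subr0 mulmxBl mulmxA.
Qed.

Lemma cvg_Fmx (G : 'M[R]_(n, p)) X (Gp : nat -> 'M[R]_(n, p)) (Gplim : 'M[R]_(n, p)) :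
  Gp @ \oo --> Gplim ->
  Fmx A B C D G X (Gp t) @[t --> \oo] --> Fmx A B C D G X Gplim.
Proof.
move=> hG; apply: cvgB; first exact: cvg_cst.
have e (K : 'M[R]_(n, p)) : col_mx K 0 = col_mx 1%:M 0 *m K :> 'M[R]_(n + n, p).
  by rewrite mul_col_mx mul1mx mul0mx.
rewrite e; under eq_fun do rewrite e.
by apply: cvg_mulmx; [apply: cvg_mulmx => //|]; exact: cvg_cst.
Qed.

Lemma Mmx_gram_bounded (G : 'M[R]_(n, p)) L (Gp : nat -> 'M[R]_(n, p))
    (Gplim : 'M[R]_(n, p)) :
  Gp @ \oo --> Gplim -> exists q : R, forall t,
  psdmx (q%:M - Mmx B D G L (Gp t) *m (Mmx B D G L (Gp t))^T).
Proof.
move=> hG.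
have cM : Mmx B D G L (Gp t) @[t --> \oo] --> Mmx B D G L Gplim.
  apply: cvgB; first exact: cvg_cst.
  have e (K : 'M[R]_(n, p)) : col_mx K 0 = col_mx 1%:M 0 *m K :> 'M[R]_(n + n, p).
    by rewrite mul_col_mx mul1mx mul0mx.
  rewrite e; under eq_fun do rewrite e.
  by apply: cvg_mulmx; [apply: cvg_mulmx => //|]; exact: cvg_cst.
have cQ := cvg_mulmx cM (cvg_trmx cM).
have [b [_ hb]] : bounded_fun (fun t => Mmx B D G L (Gp t) *m (Mmx B D G L (Gp t))^T).
  by apply: cvg_seq_bounded; apply/cvg_ex; eexists; exact: cQ.
exists ((b + 1) *+ (n + n)) => t; apply: psdmx_scalarB.
  by rewrite trmx_mul trmxK.
by rewrite lerMn2r; apply/orP; right; apply: hb => //; rewrite ltrDl.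
Qed.

(* The steady state for [th = 0] is the Kalman filter, whose error covariance
   is a Lyapunov matrix for [Abar] by the Joseph form. *)
Lemma kalman_lyapunov P : riccati_solution A B C D 0 P ->
  let G := gain A C D (risk_var 0 P) in
  pdmx P /\ pdmx (P - Abar A C G *m P *m (Abar A C G)^T).
Proof.
move=> [pP _ PE] G; split=> //.
have rvP : risk_var 0 P = P by rewrite /risk_var raddf0 subr0 invmxK.
rewrite raddf0 subr0 in PE.
have GE : G = gain A C D P by rewrite /G rvP.
rewrite {1}PE (riccati_joseph hBD hinv pP GE) addrAC subrr add0r.
exact: Bbar_gram_pd.
Qed.

(** The threshold and the neighbourhood are fixed before [th], [rho] and [X]; closeness of [X] to 0
    follows from [|X| <= K th], the limit of the bounds on the iterates. *)
Lemma near_kalman_lyapunov (Ab0 Z : 'M[R]_n) (Bb0 : 'M[R]_(n, n + p)) :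
  pdmx Z -> pdmx (Z - Ab0 *m Z *m Ab0^T) ->
  exists2 e : R, 0 < e & \forall AB \near (Ab0, Bb0),
    forall th rho X, 0 < th <= e -> backward_limit rho th AB.1 AB.2 X ->
    let Aw := AB.1 + AB.2 *m Hmx AB.1 AB.2 X in
    pdmx (Z - Aw *m Z *m Aw^T).
Proof.
move=> pZ hZ; have [K [e [K0 e0 hX]]] := X_seq_small Bb0 pZ hZ.
have [[P1 P2] [/= nP1 nP2 hP]] := closed_loop_lyapunov Bb0 pZ hZ.
have [r /= r0 hr] : exists2 r : R, 0 < r & forall X, `|X| < r -> P2 X.
  have /nbhs_ballP[r /= r0 hr] := nP2; exists r => // X Xr; apply: hr.
  by rewrite -ball_normE/= sub0r normrN.
(* [K + 1] avoids a zero denominator, and halving makes [|X| < r] strict. *)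
exists (Num.min e (r / (K + 1) / 2)).
  by rewrite lt_min e0 !divr_gt0// ltr_wpDl.
apply: filterS2 hX nP1 => -[Ab Bb] /= hX h1 th rho X /andP[th0].
rewrite le_min => /andP[the thr] [Xl [S [_ /proj1 sX _ _]]].
have XK : `|X| <= K * th.
  by apply: (mx_norm_limit_le Xl) => k; apply: hX; rewrite th0.
apply: (hP (Ab, Bb, X)) => /=.
  split=> //=; apply: hr; apply: (le_lt_trans XK).
  have : (K + 1) * th <= r / 2.
    by rewrite mulrC -ler_pdivlMr ?ltr_wpDl// -mulrA [2^-1 * _]mulrC mulrA.
  nra.
by move: sX; rewrite linearB/= tr_scalar_mx => /addIr.
Qed.

End LeastFavorableLoop.

Lemma small_tolerance_lyapunov {R : realType} n p (A : 'M[R]_n)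
    (B : 'M[R]_(n, n + p)) (C : 'M[R]_(p, n)) (D : 'M[R]_(p, n + p)) :
  B *m D^T = 0 -> col_mx B D \in unitmx -> continuous_steady_state A B C D ->
  exists2 c0 : R, 0 < c0 & forall c, 0 < c <= c0 ->
    forall th P V G, steady_state A B C D c th P V G ->
    forall rho X, backward_limit rho th (Abar A C G) (Bbar B D G) X ->
    exists2 Z, pdmx Z &
      let Aw := Abar A C G + Bbar B D G *m Hmx (Abar A C G) (Bbar B D G) X in
      pdmx (Z - Aw *m Z *m Aw^T).
Proof.
case: n A B C D => [|n] A B C D hBD hinv hcont.
  (* In dimension 0 there is no entry [P 0 0] for the risk estimate, but positivity is vacuous. *)
  exists 1 => // c _ th P V G _ rho X _; exists 1%:M; first exact: pdmx1.
  by split=> [|x]; [apply/matrixP => -[] | rewrite (flatmx0 x) eqxx].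
have [thc [thc0 [Pf [hPf cPf]]]] : exists thc : R, 0 < thc /\
    exists P : R -> 'M[R]_n.+1, (forall th, 0 <= th <= thc ->
       unique (riccati_solution A B C D th) (P th)) /\
    {within `[0, thc], continuous (fun th =>
       let G := gain A C D (risk_var th (P th)) in
       (Abar A C G, Bbar B D G))}.
  have gt0 : \forall thc \near (0 : R)^'+, 0 < thc by exact: nbhs_right_gt.
  by have [thc []] := filter_ex (filterI gt0 hcont); exists thc.
set f := (f in {within _, continuous f}) in cPf.
have thc00 : 0 <= (0 : R) <= thc by rewrite lexx ltW.
have [pZ hZ] := kalman_lyapunov hBD hinv (proj1 (hPf 0 thc00)).
set Z := Pf 0 in pZ hZ.
have [e e0 he] := near_kalman_lyapunov (f 0).2 pZ hZ.
have f0 : f @ within `[0, thc]%classic (nbhs 0) --> f 0.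
  by move/subspace_continuousP : cPf; apply; rewrite /= in_itv/= lexx ltW.
have /f0 : nbhs (f 0) [set AB | forall th rho X, 0 < th <= e ->
    backward_limit rho th AB.1 AB.2 X ->
    let Aw := AB.1 + AB.2 *m Hmx AB.1 AB.2 X in
    pdmx (Z - Aw *m Z *m Aw^T)] by exact: he.
move=> /nbhs_ballP[d /= d0 hd].
(* [thc] keeps [th] in the range of the branch [Pf], [e] serves the Lyapunov estimate, and [d / 2]
   stays strictly inside the ball given by continuity at 0. *)
pose eps := Num.min (Num.min thc e) (d / 2).
have eps0 : 0 < eps by rewrite !lt_min thc0 e0 divr_gt0.
have b0 : 0 < (B *m B^T) 0 0.
  rewrite -qform_delta; apply: (proj2 (B_gram_pd hinv)).
  apply/eqP => /matrixP/(_ 0 0)/eqP; rewrite !mxE eqxx/=.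
  by rewrite oner_eq0.
have [c0 c00 hc0] := risk_parameter_small n b0 eps0.
exists c0 => // c /andP[c_gt0 cc0] th P V G ss rho X Xl; exists Z => //.
have [[_ [th0 _ _] _ uP]] := (ss, ss).
have [VE GE thle] := steady_state_limits hinv ss.
have : th <= eps.
  apply: thle => P' th' th'0 pP' gP' pI cE; apply: (hc0 c P' th') => //.
  have := proj2 gP' (delta_mx 0 0); rewrite -/(qform _ _) qform_delta !mxE.
  by rewrite subr_ge0.
rewrite !le_min => /andP[/andP[ththc the] thd].
have thI : 0 <= th <= thc by rewrite ltW.
have PE : P = Pf th by apply: (proj2 uP); exact: (proj1 (hPf th thI)).
have gE : gain A C D (risk_var th (Pf th)) = G by rewrite -PE -VE -GE.
have dth : ball 0 d th.
  rewrite /ball/= sub0r normrN gtr0_norm//.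
  by apply: (le_lt_trans thd); rewrite ltr_pdivrMr// ltr_pMr// ltr1n.
have the' : 0 < th <= e by rewrite th0.
have thI' : th \in `[0, thc] by rewrite in_itv.
by have := hd th dth thI' th rho X the'; rewrite /= gE => /(_ Xl).
Qed.
(** * Gaussian moments and independence *)

Section Normal.
Context {R : realType}.
Local Notation mu := (@lebesgue_measure R).
Local Open Scope ereal_scope.

(** The Radon-Nikodym derivative agrees almost everywhere with [normal_pdf], since both have the
    same integral over every measurable set. *)
Lemma ge0_integral_normal_prob (m s : R) (f : R -> \bar R) U :
  (forall x, 0 <= f x) -> measurable U -> measurable_fun [set: R] f ->
  \int[normal_prob m s]_(x in U) f x =
  \int[mu]_(x in U) (f x * (normal_pdf m s x)%:E).
Proof.
move=> f0 mU mf; have dom := normal_prob_dominates m s.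
rewrite -(Radon_Nikodym_SigmaFinite.change_of_variables dom f0 mU); last first.
  exact: measurable_funTS.
have iRN := Radon_Nikodym_SigmaFinite.f_integrable dom.
apply: ae_eq_integral => //.
- apply: emeasurable_funM; first exact: measurable_funTS.
  by apply: measurable_funTS; exact: measurable_int iRN.
- apply: emeasurable_funM; first exact: measurable_funTS.
  apply: measurable_funTS; apply/measurable_EFinP; exact: measurable_normal_pdf.
- apply: ae_eqe_mul2l; apply: integral_ae_eq => //.
  + exact: integrableS iRN.
  + apply: measurable_funTS; apply/measurable_EFinP; exact: measurable_normal_pdf.
  + by move=> E _ mE; rewrite -Radon_Nikodym_SigmaFinite.f_integral.
Qed.

(* [x^2 / 4 <= exp (x^2 / 4)] compares the integrand with a wider Gaussian. *)
Lemma sqr_normal_pdf_le (x : R) :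
  (x ^+ 2 * normal_pdf 0 1 x <= 4 * normal_peak 1 / normal_peak (Num.sqrt 2) *
    normal_pdf 0 (Num.sqrt 2) x)%R.
Proof.
have s20 : (Num.sqrt 2 != 0 :> R)%R by rewrite gt_eqF// sqrtr_gt0.
rewrite !normal_pdfE ?oner_eq0// -mulrA [(_ ^-1 * _)%R]mulKf; last first.
  by rewrite gt_eqF// normal_peak_gt0.
rewrite [leLHS]mulrCA -[leRHS]mulrA [leRHS]mulrCA ler_wpM2l ?normal_peak_ge0//.
rewrite /normal_fun !subr0 expr1n sqr_sqrtr//.
have -> : (- x ^+ 2 / (1 *+ 2) = - (x ^+ 2 / 4) + - x ^+ 2 / (2 *+ 2))%R.
  by field.
rewrite expRD mulrA ler_wpM2r ?expR_ge0// expRN.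
rewrite ler_pdivrMr ?expR_gt0//.
have := expR_ge1Dx (x ^+ 2 / 4); lra.
Qed.

(** Finiteness is enough: the value only scales the noise covariance. *)
Lemma normal_second_moment : \int[normal_prob (0 : R) 1]_x (x ^+ 2)%:E < +oo.
Proof.
rewrite ge0_integral_normal_prob//; last 2 first.
  by move=> x; rewrite lee_fin sqr_ge0.
  by apply/measurable_EFinP; exact: measurable_funX.
pose K : R := (4 * normal_peak 1 / normal_peak (Num.sqrt 2))%R.
have K0 : (0 <= K)%R by rewrite divr_ge0 ?mulr_ge0 ?normal_peak_ge0.
apply: (@le_lt_trans _ _ (\int[mu]_x (K%:E * (normal_pdf 0 (Num.sqrt 2) x)%:E))).
  apply: ge0_le_integral => //=.
  - by move=> x _; rewrite mule_ge0 ?lee_fin ?sqr_ge0 ?normal_pdf_ge0.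
  - apply: emeasurable_funM; apply/measurable_EFinP; first exact: measurable_funX.
    exact: measurable_normal_pdf.
  - apply: emeasurable_funM => //; apply/measurable_EFinP.
    exact: measurable_normal_pdf.
  - by move=> x _; rewrite -!EFinM lee_fin sqr_normal_pdf_le.
rewrite ge0_integralZl//; last 2 first.
  by apply/measurable_EFinP; exact: measurable_normal_pdf.
  by move=> x _; rewrite lee_fin normal_pdf_ge0.
by rewrite integral_normal_pdf mule1 ltry.
Qed.

(** Symmetry of the density, stated for positive and negative parts so that substitution for
    nonnegative integrands applies. Once the parts are known to be finite, this is the zero mean. *)
Lemma normal_half_moments :
  \int[normal_prob (0 : R) 1]_x maxe (- x%:E) 0%E =
  \int[normal_prob (0 : R) 1]_x maxe x%:E 0%E.
Proof.
pose g (x : R) := (`|x| * normal_pdf 0 1 x)%R.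
have cg : continuous g.
  move=> x; apply: cvgM; first exact: norm_continuous.
  by apply: continuous_normal_pdf; exact: oner_neq0.
have h := @ge0_integration_by_substitutionNy R g 0.
rewrite oppr0 in h; have {h} := h (continuous_subspaceT cg).
have g0 : {in `]-oo, 0%R[, forall x, (0 <= g x)%R}.
  by move=> x _; rewrite mulr_ge0 ?normal_pdf_ge0.
move=> /(_ g0) h.
have gN : g \o -%R = g.
  apply/funext => x; rewrite /g/= normrN; congr (_ * _)%R.
  by rewrite !normal_pdfE ?oner_eq0// /normal_fun !subr0 sqrrN.
have mE : measurable_fun [set: R] (EFin : R -> \bar R) by exact/measurable_EFinP.
have mp : measurable_fun [set: R] (fun x : R => maxe x%:E 0%E).
  by apply: measurable_maxe => //; exact: measurable_cst.
have mn : measurable_fun [set: R] (fun x : R => maxe (- x%:E) 0%E).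
  apply: measurable_maxe; last exact: measurable_cst.
  exact: (measurableT_comp (@oppe_measurable R setT) mE).
have p0 (x : R) : 0 <= maxe x%:E 0%E by rewrite le_max lexx orbT.
have n0 (x : R) : 0 <= maxe (- x%:E) 0%E by rewrite le_max lexx orbT.
rewrite (ge0_integral_normal_prob 0 1 n0 measurableT mn).
rewrite (ge0_integral_normal_prob 0 1 p0 measurableT mp).
transitivity (\int[mu]_(x in `]-oo, 0%R]) (g x)%:E).
  rewrite [RHS]integral_mkcond; apply: eq_integral => x _.
  rewrite patchE mem_setE in_itv/=; case: (leP x 0%R) => x0.
    by rewrite max_l ?lee_fin ?oppr_ge0// -EFinM /g ler0_norm.
  by rewrite max_r ?mul0e// lee_fin oppr_le0 ltW.
rewrite h gN [LHS]integral_mkcond; apply: eq_integral => x _.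
rewrite patchE mem_setE in_itv/= andbT; case: (leP 0%R x) => x0.
  by rewrite max_l ?lee_fin// -EFinM /g ger0_norm.
by rewrite max_r ?mul0e// lee_fin ltW.
Qed.

End Normal.

Section SquareIntegrable.
Context {d : measure_display} {T : measurableType d} {R : realType}.
Variable Pr : probability T R.
Local Open Scope ereal_scope.

Lemma Lfun2_sqr (X : {RV Pr >-> R}) : \int[Pr]_w (X w ^+ 2)%:E < +oo ->
  (X : T -> R) \in Lfun Pr 2%:E.
Proof.
move=> h; rewrite inE; apply/andP; split; rewrite inE//=.
rewrite /finite_norm unlock /Lnorm poweR_lty//=.
apply: le_lt_trans h; apply: ge0_le_integral => //.
- apply/measurable_EFinP.
  apply/(@measurableT_comp _ _ _ _ _ _ (fun x : R => x `^ 2)%R) => //.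
  exact/measurableT_comp.
- by apply/measurable_EFinP; exact: measurable_funX.
- by move=> w _; rewrite /= lee_fin powR_mulrn// real_normK ?num_real.
Qed.

Lemma Lfun2_Lfun1 (X : T -> R) : X \in Lfun Pr 2%:E -> X \in Lfun Pr 1.
Proof. by apply: Lfun_subset12; rewrite fin_num_measure. Qed.

Lemma standard_normal_moments (X : {RV Pr >-> R}) :
  distribution Pr X = normal_prob 0 1 :> (set _ -> \bar R) ->
  [/\ (X : T -> R) \in Lfun Pr 2%:E, 'E_Pr[X] = 0 &
      covariance Pr X X = \int[normal_prob (0 : R) 1]_x (x ^+ 2)%:E].
Proof.
move=> hX.
have tr (f : R -> \bar R) U : (forall x, 0 <= f x) -> measurable U ->
    measurable_fun [set: R] f ->
    \int[Pr]_(w in X @^-1` U) f (X w) = \int[normal_prob 0 1]_(x in U) f x.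
  move=> f0 mU mf.
  have mX : measurable_fun [set: T] (X : T -> measurableTypeR R).
    exact: (@measurable_funPT _ _ _ _ X).
  rewrite -(@ge0_integral_pushforward _ _ T (measurableTypeR R) R X mX Pr U f)//.
    by apply: eq_measure_integral => V mV _; exact: (congr1 (fun m => m V) hX).
  exact: (measurable_funTS mf).
have sqrE : \int[Pr]_w (X w ^+ 2)%:E = \int[normal_prob (0 : R) 1]_x (x ^+ 2)%:E.
  have := tr (fun x => (x ^+ 2)%:E) setT; rewrite preimage_setT; apply=> //.
    by move=> x; rewrite lee_fin sqr_ge0.
  by apply/measurable_EFinP; exact: measurable_funX.
have X2 : (X : T -> R) \in Lfun Pr 2%:E.
  by apply: Lfun2_sqr; rewrite sqrE; exact: normal_second_moment.
suff X0 : 'E_Pr[X] = 0.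
  split=> //; have X1 := Lfun2_Lfun1 X2.
  rewrite (covarianceE X1 X1 (Lfun2_mul_Lfun1 X2 X2)) X0 mule0 sube0 -sqrE unlock.
  by apply: eq_integral => w _; rewrite expr2.
have /Lfun1_integrable iX := Lfun2_Lfun1 X2.
have posE : \int[Pr]_w maxe (X w)%:E 0 = \int[normal_prob 0 1]_x maxe x%:E 0.
  rewrite -(tr (fun x => maxe x%:E 0) setT _ measurableT) ?preimage_setT//.
    by move=> x; rewrite le_max lexx orbT.
  exact: measurable_maxe.
have negE : \int[Pr]_w maxe (- (X w)%:E) 0 =
    \int[normal_prob 0 1]_x maxe (- x%:E) 0.
  rewrite -(tr (fun x => maxe (- x%:E) 0) setT _ measurableT) ?preimage_setT//.
    by move=> x; rewrite le_max lexx orbT.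
  apply: measurable_maxe => //.
  by apply: (measurableT_comp (@oppe_measurable R setT)); exact/measurable_EFinP.
have := integrable_fin_num measurableT (integrable_funepos measurableT iX).
have fposE : \int[Pr]_w (EFin \o X)^\+ w = \int[Pr]_w maxe (X w)%:E 0.
  by apply: eq_integral => w _; rewrite funeposE.
have fnegE : \int[Pr]_w (EFin \o X)^\- w = \int[Pr]_w maxe (- (X w)%:E) 0.
  by apply: eq_integral => w _; rewrite funenegE.
rewrite fposE posE => h; rewrite unlock -[LHS]/(\int[Pr]_w (EFin \o X) w).
by rewrite integralE fposE fnegE posE negE normal_half_moments subee.
Qed.

(* The joint law of [(X, Y)] is the product of the laws, so Fubini applies. *)
Lemma independent_expectationM (X Y : {RV Pr >-> R}) :
  (forall A B : set R, measurable A -> measurable B ->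
    Pr (X @^-1` A `&` Y @^-1` B) = Pr (X @^-1` A) * Pr (Y @^-1` B)) ->
  (X : T -> R) \in Lfun Pr 2%:E -> (Y : T -> R) \in Lfun Pr 2%:E ->
  'E_Pr[X \* Y] = 'E_Pr[X] * 'E_Pr[Y].
Proof.
move=> hXY X2 Y2.
have /Lfun1_integrable iX := Lfun2_Lfun1 X2.
have /Lfun1_integrable iY := Lfun2_Lfun1 Y2.
have /Lfun1_integrable iXY := Lfun2_mul_Lfun1 X2 Y2.
have mphi : measurable_fun [set: T] (fun w => (X w, Y w)).
  exact: measurable_fun_pair.
pose Phi : {RV Pr >-> (R * R)%type} := mfun_Sub (mem_set mphi).
pose m1 := distribution Pr X; pose m2 := distribution Pr Y.
pose f (z : R * R) := (z.1 * z.2)%:E.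
have mf : measurable_fun [set: R * R] f.
  apply/measurable_EFinP; apply: measurable_funM; first exact: measurable_fst.
  exact: measurable_snd.
have jointE A : measurable A -> distribution Pr Phi A = (m1 \x m2) A.
  move=> mA; apply/esym; apply: product_measure_unique mA => U V mU mV.
  exact: hXY.
have mE : measurable_fun [set: R] (EFin : R -> \bar R) by exact/measurable_EFinP.
have idE (Z : {RV Pr >-> R}) : Pr.-integrable [set: T] (EFin \o Z) ->
    (distribution Pr Z).-integrable [set: R] EFin /\
    \int[distribution Pr Z]_x x%:E = 'E_Pr[Z].
  move=> iZ; split; last by rewrite integral_distribution// unlock.
  apply/integrableP; split=> //.
  rewrite (ge0_integral_distribution Z (f := fun x => `|x%:E|))//.
    by have /integrableP[] := iZ.
  exact: measurableT_comp.
have ifp : (m1 \x m2).-integrable [set: R * R] f.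
  apply/integrableP; split=> //.
  rewrite (eq_measure_integral (distribution Pr Phi)); last first.
    by move=> A mA _; exact: (esym (jointE _ mA)).
  rewrite (ge0_integral_distribution Phi (f := fun z => `|f z|))//.
    by have /integrableP[] := iXY.
  exact: measurableT_comp.
transitivity (\int[m1 \x m2]_z f z).
  rewrite unlock (eq_measure_integral (distribution Pr Phi)); last first.
    by move=> A mA _; exact: (esym (jointE _ mA)).
  by rewrite integral_distribution.
rewrite -(integral12_prod_meas1 ifp) /fubini_F /f/=.
have [iX1 <-] := idE X iX; have [iY1 <-] := idE Y iY.
under eq_integral => x _ do (under eq_integral => y _ do rewrite EFinM;
  rewrite integralZl//).
set EY := \int[distribution Pr Y]_x x%:E.
have EYf : EY \is a fin_num.
  by rewrite /EY (proj2 (idE Y iY)) expectation_fin_num// Lfun2_Lfun1.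
by rewrite -(fineK EYf) integralZr.
Qed.

Local Close Scope ereal_scope.

Lemma Lfun2_lincomb (I : Type) (r : seq I) (a : I -> R) (U : I -> T -> R) :
  (forall i, U i \in Lfun Pr 2%:E) ->
  (fun w => \sum_(i <- r) a i * U i w) \in Lfun Pr 2%:E.
Proof.
move=> hU; have p1 : (1 <= 2%:E :> \bar R)%E by rewrite lee1n.
have [L0 LD] := Lfun_submod_closed Pr p1.
elim: r => [|i r IH].
  by rewrite (_ : (fun _ => _) = 0)//; apply/funext => w; rewrite big_nil.
rewrite (_ : (fun _ => _) = a i *: U i + (fun w => \sum_(j <- r) a j * U j w)).
  exact: LD.
by apply/funext => w; rewrite big_cons.
Qed.

Lemma expectation_lincomb (I : Type) (r : seq I) (a : I -> R) (U : I -> T -> R) :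
  (forall i, U i \in Lfun Pr 2%:E) ->
  ('E_Pr[fun w => (\sum_(i <- r) a i * U i w)%R] =
   \sum_(i <- r) (a i)%:E * 'E_Pr[U i])%E.
Proof.
move=> hU; elim: r => [|i r IH].
  rewrite big_nil -[RHS](expectation_cst Pr 0); congr expectation.
  by apply/funext => w; rewrite big_nil.
rewrite big_cons -IH -expectationZl ?Lfun2_Lfun1// -expectationD.
- by congr expectation; apply/funext => w; rewrite big_cons/= mulrC.
- rewrite (_ : (a i \o* U i) = (fun w => \sum_(j <- [:: i]) a j * U j w)).
    by apply: Lfun2_Lfun1; exact: Lfun2_lincomb.
  by apply/funext => w; rewrite big_seq1/= mulrC.
- by apply: Lfun2_Lfun1; exact: Lfun2_lincomb.
Qed.

Lemma covariance_Lfun2_fin_num (X Y : T -> R) :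
  X \in Lfun Pr 2%:E -> Y \in Lfun Pr 2%:E -> covariance Pr X Y \is a fin_num.
Proof.
move=> X2 Y2; apply: covariance_fin_num; [exact: Lfun2_Lfun1..|].
exact: (Lfun2_mul_Lfun1 X2 Y2).
Qed.

(** [fine] is additive here because square integrability makes every covariance finite. *)
Lemma covariance_lincomb (I : Type) (r : seq I) (a : I -> R) (U : I -> T -> R)
    (W : T -> R) : (forall i, U i \in Lfun Pr 2%:E) -> W \in Lfun Pr 2%:E ->
  fine (covariance Pr (fun w => \sum_(i <- r) a i * U i w) W) =
  \sum_(i <- r) a i * fine (covariance Pr (U i) W).
Proof.
move=> hU hW; elim: r => [|i r IH].
  rewrite big_nil -[RHS]/(fine 0%E) -(covariance_cst_l Pr 0 W).
  by congr (fine (covariance _ _ _)); apply/funext => w; rewrite big_nil.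
have hi : (a i \o* U i) \in Lfun Pr 2%:E.
  rewrite (_ : (a i \o* U i) = (fun w => \sum_(j <- [:: i]) a j * U j w)).
    exact: Lfun2_lincomb.
  by apply/funext => w; rewrite big_seq1/= mulrC.
have hr : (fun w => \sum_(j <- r) a j * U j w) \in Lfun Pr 2%:E.
  exact: Lfun2_lincomb.
rewrite big_cons -IH.
have -> : (fun w => \sum_(j <- i :: r) a j * U j w) =
    (a i \o* U i) \+ (fun w => \sum_(j <- r) a j * U j w).
  by apply/funext => w; rewrite big_cons/= mulrC.
rewrite covarianceDl// fineD ?covariance_Lfun2_fin_num//; congr (_ + _).
rewrite (covarianceZl _ (Lfun2_Lfun1 (hU i)) (Lfun2_Lfun1 hW)
  (Lfun2_mul_Lfun1 (hU i) hW)).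
by rewrite fineM// covariance_Lfun2_fin_num.
Qed.

Lemma independent_covariance (X Y : {RV Pr >-> R}) :
  (forall A B : set R, measurable A -> measurable B ->
    Pr (X @^-1` A `&` Y @^-1` B) = (Pr (X @^-1` A) * Pr (Y @^-1` B))%E) ->
  (X : T -> R) \in Lfun Pr 2%:E -> (Y : T -> R) \in Lfun Pr 2%:E ->
  fine (covariance Pr X Y) = 0.
Proof.
move=> hXY X2 Y2; have h := independent_expectationM hXY X2 Y2.
rewrite (covarianceE (Lfun2_Lfun1 X2) (Lfun2_Lfun1 Y2) (Lfun2_mul_Lfun1 X2 Y2)).
have -> : ('E_Pr[((X : T -> R) * (Y : T -> R))%R] = 'E_Pr[X] * 'E_Pr[Y])%E := h.
rewrite subee//.
by rewrite fin_numM// expectation_fin_num// Lfun2_Lfun1.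
Qed.

End SquareIntegrable.

(** * Moments of the joint error *)

Section LinearRecursion.
Context {d : measure_display} {T : measurableType d} {R : realType}.
Variable Pr : probability T R.

Lemma white_gaussian_moments k (eps : nat -> 'I_k -> {RV Pr >-> R}) t :
  white_gaussian eps -> square_integrable (eps t) /\ zero_mean (eps t).
Proof.
by move=> [h _]; split=> i; have [] := standard_normal_moments (h t i).
Qed.

Lemma white_gaussian_uncorrelated k (eps : nat -> 'I_k -> {RV Pr >-> R}) t i s j :
  white_gaussian eps -> (t, i) != (s, j) ->
  fine (covariance Pr (eps t i) (eps s j)) = 0.
Proof.
move=> he tisj; have [_ hind] := he.
apply: independent_covariance.
- move=> U V mU mV.
  have := hind [:: (t, i); (s, j)] (fun q => if q == (t, i) then U else V).
  rewrite !big_cons !big_nil /= eqxx (negPf (_ : (s, j) != (t, i))) 1?eq_sym//.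
  rewrite setIT mule1; apply; first by rewrite /= inE tisj.
  by move=> q; case: ifP.
- by have [] := white_gaussian_moments t he.
- by have [] := white_gaussian_moments s he.
Qed.

Lemma white_gaussian_covmx k (eps : nat -> 'I_k -> {RV Pr >-> R}) t :
  white_gaussian eps ->
  covmx (eps t) = (fine (\int[normal_prob (0 : R) 1]_x (x ^+ 2)%:E)%E)%:M.
Proof.
move=> he; apply/matrixP => i j; rewrite !mxE; have [->|ij] := eqVneq i j.
  by have [_ _ ->] := standard_normal_moments (proj1 he t j).
by rewrite mulr0n white_gaussian_uncorrelated// xpair_eqE eqxx.
Qed.

Lemma covmx_linear a b (K : 'M[R]_(b, a)) (X : 'I_a -> {RV Pr >-> R})
    (Y : 'I_b -> {RV Pr >-> R}) : square_integrable X ->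
  (forall w, sample Y w = K *m sample X w) ->
  covmx Y = K *m covmx X *m K^T.
Proof.
move=> hX hY.
have YE i : (Y i : T -> R) = (fun w => \sum_j K i j * X j w).
  apply/funext => w; have /matrixP/(_ i 0) := hY w; rewrite !mxE => ->.
  by apply: eq_bigr => j _; rewrite mxE.
have Y2 i : (Y i : T -> R) \in Lfun Pr 2%:E by rewrite YE; exact: Lfun2_lincomb.
apply/matrixP => i j; rewrite -mulmxA !mxE {1}YE covariance_lincomb//.
apply: eq_bigr => l _; congr (_ * _).
rewrite covarianceC YE covariance_lincomb// !mxE; apply: eq_bigr => q _.
by rewrite !mxE covarianceC mulrC.
Qed.

Lemma linear_zero_mean a b (K : 'M[R]_(b, a)) (X : 'I_a -> {RV Pr >-> R})
    (Y : 'I_b -> {RV Pr >-> R}) : square_integrable X -> zero_mean X ->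
  (forall w, sample Y w = K *m sample X w) -> square_integrable Y /\ zero_mean Y.
Proof.
move=> hX X0 hY.
have YE i : (Y i : T -> R) = (fun w => \sum_j K i j * X j w).
  apply/funext => w; have /matrixP/(_ i 0) := hY w; rewrite !mxE => ->.
  by apply: eq_bigr => j _; rewrite mxE.
split=> i; rewrite YE; first exact: Lfun2_lincomb.
by rewrite expectation_lincomb// big1// => j _; rewrite X0 mule0.
Qed.

Lemma linear_uncorrelated a b (K : 'M[R]_(b, a)) (X : 'I_a -> {RV Pr >-> R})
    (Y : 'I_b -> {RV Pr >-> R}) (W : {RV Pr >-> R}) i : square_integrable X ->
  (W : T -> R) \in Lfun Pr 2%:E ->
  (forall j, fine (covariance Pr (X j) W) = 0) ->
  (forall w, sample Y w = K *m sample X w) ->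
  fine (covariance Pr (Y i) W) = 0.
Proof.
move=> hX hW XW hY.
have -> : (Y i : T -> R) = (fun w => \sum_j K i j * X j w).
  apply/funext => w; have /matrixP/(_ i 0) := hY w; rewrite !mxE => ->.
  by apply: eq_bigr => j _; rewrite mxE.
by rewrite covariance_lincomb// big1// => j _; rewrite XW mulr0.
Qed.

(** Stacking [e_t] on [eps_t] makes the error recursion a single linear map [[F_t M_t]], to which
    the moment formulas for linear images apply. *)
Definition append_rv a b (X : 'I_a -> {RV Pr >-> R}) (Y : 'I_b -> {RV Pr >-> R})
    (j : 'I_(a + b)) : {RV Pr >-> R} :=
  match fintype.split j with inl i => X i | inr i => Y i end.

Lemma sample_append a b (X : 'I_a -> {RV Pr >-> R}) (Y : 'I_b -> {RV Pr >-> R}) w :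
  sample (append_rv X Y) w = col_mx (sample X w) (sample Y w).
Proof.
apply/matrixP => i j; rewrite !mxE /append_rv.
by case: (fintype.split i) => l; rewrite mxE.
Qed.

Lemma covmx_append a b (X : 'I_a -> {RV Pr >-> R}) (Y : 'I_b -> {RV Pr >-> R}) :
  (forall i j, fine (covariance Pr (X i) (Y j)) = 0) ->
  covmx (append_rv X Y) = block_mx (covmx X) 0 0 (covmx Y).
Proof.
move=> h; apply/matrixP => i j; rewrite !mxE /append_rv.
case: (fintype.split i) => l; rewrite mxE; case: (fintype.split j) => q; rewrite !mxE//.
by rewrite covarianceC h.
Qed.

Lemma joint_error_moments n k (F : nat -> 'M[R]_(n + n))
    (M : nat -> 'M[R]_(n + n, k)) (V0 : 'M[R]_n)
    (eps : nat -> 'I_k -> {RV Pr >-> R}) (e : nat -> 'I_(n + n) -> {RV Pr >-> R}) t :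
  joint_error F M V0 eps e ->
  [/\ square_integrable (e t), zero_mean (e t) & covmx (e t.+1) =
    F t *m covmx (e t) *m (F t)^T + M t *m covmx (eps t) *m (M t)^T].
Proof.
case=> he [e2 e0 _] hind erec.
have rec s w : sample (e s.+1) w =
    row_mx (F s) (M s) *m sample (append_rv (e s) (eps s)) w.
  by rewrite sample_append mul_row_col erec.
have eps2 s := proj1 (white_gaussian_moments s he).
have eps0 s := proj2 (white_gaussian_moments s he).
have append2 s : square_integrable (e s) ->
    square_integrable (append_rv (e s) (eps s)).
  by move=> es i; rewrite /append_rv; case: (fintype.split i) => j;
    [exact: es|exact: eps2].
have append0 s : zero_mean (e s) -> zero_mean (append_rv (e s) (eps s)).
  by move=> es i; rewrite /append_rv; case: (fintype.split i) => j;
    [exact: es|exact: eps0].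
(* The invariant concerns all noises from time [t] on, since the step to [t + 1] uses up [eps_t].
   Independence of the initial error from the noise enters only at time 0; afterwards
   uncorrelatedness is propagated. *)
have [es2 es0 esu] : [/\ square_integrable (e t), zero_mean (e t) &
    forall s i j, (t <= s)%N -> fine (covariance Pr (e t i) (eps s j)) = 0].
  elim: t => [|t [IH2 IH0 IHu]].
    split=> // s i j _; apply: independent_covariance; [|exact: e2|exact: eps2].
    move=> U V mU mV; apply: hind; apply: sub_sigma_algebra.
      by exists i => //; exists U => //; rewrite setTI.
    by exists (s, j) => //; exists V => //; rewrite setTI.
  have [] := linear_zero_mean (append2 _ IH2) (append0 _ IH0) (rec t).
  split=> // s i j ts; apply: linear_uncorrelated (append2 _ IH2) (eps2 s j) _ (rec t).
  move=> l; rewrite /append_rv; case: (fintype.split l) => q; first by rewrite IHu// ltnW.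
  by rewrite white_gaussian_uncorrelated// xpair_eqE ltn_eqF.
split=> //; rewrite (covmx_linear (append2 _ es2) (rec t)) covmx_append => [|i j].
  by rewrite tr_row_mx mul_row_block mul_row_col !mulmx0 addr0 add0r.
exact: esu.
Qed.

End LinearRecursion.

Theorem corollary4p1 (R : realType) (n p : nat)
  (A : 'M[R]_n) (B : 'M[R]_(n, n + p)) (C : 'M[R]_(p, n)) (D : 'M[R]_(p, n + p))
  (hAB : reachable A B) (hAC : observable A C) (hBD : B *m D^T = 0)
  (hinv : col_mx B D \in unitmx)
  (P0 : 'M[R]_n) (hP0 : pdmx P0)
  (cmax : R) (hcmax : 0 < cmax)
  (hlim : forall c, 0 < c <= cmax ->
     exists th P V G, steady_state A B C D c th P V G)
  (hcont : continuous_steady_state A B C D)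
  (cbar rho : R) (hcbar : 0 < cbar <= cmax) (hrho : 1 < rho)
  (hcbar_rho : cbar_condition A B C D cbar rho)
  (Gp : nat -> 'M[R]_(n, p)) (Gplim : 'M[R]_(n, p))
  (hGp : Gp @ \oo --> Gplim) (hstab : stable (A - Gplim *m C)) :
  exists c0 : R, 0 < c0 <= cbar /\
  forall c, 0 < c <= c0 ->
  forall th P V G, steady_state A B C D c th P V G ->
  forall X, backward_limit rho th (Abar A C G) (Bbar B D G) X ->
  forall L : 'M[R]_(n + p), Ktilde (Bbar B D G) X = L *m L^T ->
  forall (d : measure_display) (T : measurableType d) (Pr : probability T R)
    (eps : nat -> 'I_(n + p) -> {RV Pr >-> R})
    (e : nat -> 'I_(n + n) -> {RV Pr >-> R}),
  joint_error (fun t => Fmx A B C D G X (Gp t)) (fun t => Mmx B D G L (Gp t))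
    P0 eps e ->
  [/\ forall t, square_integrable (prediction_error e t),
      forall t, zero_mean (prediction_error e t) &
      exists beta : R, forall t, `|covmx (prediction_error e t)| <= beta].
Proof.
have [c1 c10 hc1] := small_tolerance_lyapunov hBD hinv hcont.
have /andP[cbar0 _] := hcbar.
exists (Num.min c1 cbar); split; first by rewrite lt_min c10 cbar0 ge_min lexx orbT.
move=> c /andP[c0]; rewrite le_min => /andP[cc1 _] th P V G ss X hX L _ d T Pr
  eps e he.
have cc : 0 < c <= c1 by rewrite c0.
have [Z2 pZ2 hZ2] := hc1 c cc th P V G ss rho X hX.
have [Z1 pZ1 hZ1] := stable_lyapunov hstab.
have [Z pZ hZ] := block_lyapunov ((B - Gplim *m D) *m
  Hmx (Abar A C G) (Bbar B D G) X) pZ1 hZ1 pZ2 hZ2.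
have hmom t := joint_error_moments t he.
split.
- by move=> t i; have [e2 _ _] := hmom t; exact: e2.
- by move=> t i; have [_ e0 _] := hmom t; exact: e0.
pose v := fine (\int[normal_prob (0 : R) 1]_x (x ^+ 2)%:E)%E.
have v0 : 0 <= v.
  by rewrite fine_ge0// integral_ge0// => x _; rewrite lee_fin sqr_ge0.
pose Q t := v *: (Mmx B D G L (Gp t) *m (Mmx B D G L (Gp t))^T).
have rec t : covmx (e t.+1) = Fmx A B C D G X (Gp t) *m covmx (e t) *m
    (Fmx A B C D G X (Gp t))^T + Q t.
  have [_ _ ->] := hmom t; have [wg _ _ _] := he.
  by rewrite (white_gaussian_covmx t wg) mul_mx_scalar -scalemxAl.
have psdQ t : psdmx (Q t) by apply: psdmxZ => //; exact: psdmx_gram.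
(* Positivity is inherited from [P0] through the recursion. *)
have psdPi t : psdmx (covmx (e t)).
  elim: t => [|t IH].
    have [_ [_ _ ->] _ _] := he.
    exact/pdmx_psd/pdmx_block_diag.
  by rewrite rec; apply: psdmxD => //; exact: psdmx_congr.
have [q hq] := Mmx_gram_bounded B D G L hGp.
have hQ t : psdmx ((v * q)%:M - Q t).
  by rewrite /Q -scale_scalar_mx -scalerBr; exact: psdmxZ.
rewrite -FmxE in hZ.
have cF : Fmx A B C D G X (Gp t) @[t --> \oo] --> Fmx A B C D G X Gplim.
  exact: cvg_Fmx.
have [b hb] := lyapunov_bounded pZ hZ cF hQ psdPi rec.
(* The covariance of [e'_t] is the upper left block of that of the joint error, and the norm is
   entrywise. *)
exists b => t; apply: mx_norm_le => [|i j]; first exact: le_trans (hb t).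
rewrite mxE; apply: le_trans (hb t).
by have := mx_norm_entry (covmx (e t)) (lshift n i) (lshift n j); rewrite mxE.
Qed.
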